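(* Let $a\ge b\ge 0$ with $a>0$. There are constants $c_3,c_4>0$, depending only on $a,b$, such that for any $t,x,B>0$ and any integers $1\le k\le m$, $$\mathbb{P}\Big( \mathcal{L}_m^{(\mathcal{E}_{a,b}^{B})} (\Lambda_{t,x}) \ge k\Big) \le \Big( \frac{c_3 ( B t^b/x^a)^{1/a} m }{k^{(a+b+1)/a}} \Big)^{ k},$$ $$\mathbb{P}\Big( \mathcal{L}_m^{(\mathcal{E}_{a,b}^{B})} (\Lambda_{t,x}) \le k\Big) \le \exp\bigg\{ c_4 k \Big( 1- c_4 \Big( \frac{ (B t^b/x^a)^{1/a} }{ k^{(b+1)/a} }\wedge 1 \Big) \frac{m}{k} \Big) \bigg\}.$$ As a consequence, there is a constant $C>0$ such that for any fixed $t,x,B>0$ and $a\ge b\ge 0$ with $a>0$, $\mathbb{P}$-a.s. there is some $m_0$ such that $$ \frac{1}{C}\le \frac{\mathcal{L}_m^{(\mathcal{E}_{a,b}^{B})} (\Lambda_{t,x}) }{ ( B t^b/x^a)^{1/(a+b+1)}\, m^{a/(a+b+1)} } \le C \quad \text{ for all } m\ge m_0 .$$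
   Context: For $t,x>0$ let $\Lambda_{t,x}=[0,t]\times[-x,x]$. Let $Z_1,Z_2,\dots$ be i.i.d. random points uniform in $\Lambda_{t,x}$, with law $\mathbb{P}$, and set $\Upsilon_m=\{Z_1,\dots,Z_m\}$. The first coordinate of a point is viewed as time. A finite set $\Delta=\{(t_i,x_i)\}_{1\le i\le k}\subset\mathbb{R}_+\times\mathbb{R}$ is called directed if its points can be labelled so that $0<t_1<\cdots<t_k$. For such a set (points ordered by increasing $t_i$, with the convention $(t_0,x_0)=(0,0)$) and $a\ge b\ge 0$, $a>0$, define the $(a,b)$-entropy $$\mathrm{Ent}_{a,b}(\Delta)=\sum_{i=1}^k\frac{|x_i-x_{i-1}|^a}{|t_i-t_{i-1}|^b}.$$ For $B>0$ let $\mathcal{E}_{a,b}^{B}=\{\Delta\subset\mathbb{R}_+\times\mathbb{R} : \Delta \text{ directed},\ \mathrm{Ent}_{a,b}(\Delta)\le B\}$ (the empty set is included). Define $$\mathcal{L}_m^{(\mathcal{E}_{a,b}^{B})}(\Lambda_{t,x})=\sup\{|\Delta| : \Delta\subset\Upsilon_m,\ \Delta\in\mathcal{E}_{a,b}^{B}\}.$$ Notation: $u\wedge v=\min(u,v)$. *)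

(* Defs.v *)
From HB Require Import structures.
From mathcomp Require Import all_boot all_order all_algebra finmap.
From mathcomp Require Import all_classical all_reals all_analysis.

Set Implicit Arguments.
Unset Strict Implicit.
Unset Printing Implicit Defensive.

Import Order.TTheory GRing.Theory Num.Theory.
Import numFieldNormedType.Exports.

Local Open Scope classical_set_scope.
Local Open Scope ring_scope.

Section Probability.
Context {R : realType}.

(* Mutual independence of a sequence of random elements: the product rule
   holds for every finite subfamily. *)
Definition mutually_independent d d' (T : measurableType d)
    (T' : measurableType d') (P : probability T R) (X : nat -> {RV P >-> T'}) :=
  forall (I : {fset nat}) (A : nat -> set T'),
    (forall i, i \in I -> measurable (A i)) ->
    P (\bigcap_(i in [set` I]) (X i @^-1` A i)) =
    (\prod_(i <- I) P (X i @^-1` A i))%E.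

Definition uniform_on d d' (T : measurableType d) (T' : measurableType d')
    (P : probability T R) (mu : {measure set T' -> \bar R}) (D : set T')
    (X : {RV P >-> T'}) :=
  forall A, measurable A ->
    distribution P X A = (mu (A `&` D) * ((fine (mu D))^-1)%:E)%E.

End Probability.

Section Entropy.
Context {R : realType}.

Definition plane := (measurableTypeR R * measurableTypeR R)%type.

Definition plane_measure : {measure set plane -> \bar R} :=
  (@lebesgue_measure R \x @lebesgue_measure R)%E.

(* The first coordinate of a point is its time. *)
Definition box (t x : R) : set plane := `[0, t] `*` `[- x, x].

Definition directed (D : {fset plane}) : Prop :=
  exists2 s : seq plane,
    perm_eq s D & path (fun u v : R => u < v) 0 [seq p.1 | p <- s].

(* When [D] is directed this is its only labelling by increasing times. *)
Definition time_sort (D : {fset plane}) : seq plane :=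
  sort (fun p q : plane => (p.1 : R) <= q.1) D.

Definition entropy (a b : R) (D : {fset plane}) : R :=
  let p := nth (0, 0) ((0, 0) :: time_sort D) : nat -> R * R in
  \sum_(1 <= i < #|` D|.+1)
    `|(p i).2 - (p i.-1).2| `^ a / `|(p i).1 - (p i.-1).1| `^ b.

Definition entropy_class (a b B : R) : set {fset plane} :=
  [set D | directed D /\ entropy a b D <= B].

(* The largest cardinality of a subset of [Y] in the class [E]. *)
Definition last_passage (E : set {fset plane}) (Y : {fset plane}) : nat :=
  \max_(D <- fpowerset Y | `[< E D >]) #|` D|.

(* The points Z_1, Z_2, ... are indexed from 0. *)
Definition sample (Omega : Type) (Z : nat -> Omega -> plane) (m : nat)
    (w : Omega) : {fset plane} :=
  [fset Z i w | i in iota 0 m]%fset.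

Definition entropy_lpp (Omega : Type) (Z : nat -> Omega -> plane)
    (a b B : R) (m : nat) (w : Omega) : nat :=
  last_passage (entropy_class a b B) (sample Z m w).

End Entropy.

Arguments plane : clear implicits.

(* Main.v *)
(* A prefix of a chain costs no more than the chain, so [k <= L] holds exactly
   when some [k] sample points, taken in the order of time, form a chain of
   entropy at most [B].

   Upper tail: put a grid of mesh [t / k] in time and
   [((B / k) (t / k)^b)^(1/a)] in space on the box.  A chain is determined up to
   its cells by the rises of the time index and the rounded link costs, both
   summing to at most [k], and by the space increments, for which a link with
   cost index [l] and rise [n] leaves [O(l^(1/a) n^(b/a))] choices.  As
   [l + 1 <= 2^l], there are at most [C^k] cell sequences, and a union bound over
   the cells and the indices of the points needs only independence on
   rectangles, no integration.

   Lower tail: at least [k] among [2k] well separated thin slots of the box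
   contain no point when [L <= k], since one point in each occupied slot gives a
   chain; a union bound over the sets of empty slots concludes.

   The constants have the form [C * C'^((1+b)/a)], so they stay bounded after
   raising to the power [a / (a+b+1)]; with Borel-Cantelli this gives a
   constant independent of [a] and [b] in the almost sure statement. *)
Require Import Defs.
From HB Require Import structures.
From mathcomp Require Import all_boot all_order all_algebra finmap.
From mathcomp Require Import all_classical all_reals all_analysis.
From mathcomp Require Import measurable_realfun.
From mathcomp Require Import zify ring lra.

Set Implicit Arguments.
Unset Strict Implicit.
Unset Printing Implicit Defensive.

Import Order.TTheory GRing.Theory Num.Theory.
Import numFieldNormedType.Exports.

Local Open Scope classical_set_scope.
Local Open Scope ring_scope.

(** * Chains: time-ordered sequences in place of directed finite sets *)

Section Chains.
Context {R : realType}.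
Implicit Types (a b B : R) (p : nat -> plane R).

(** The convention $(t_0,x_0)=(0,0)$: points are numbered from $0$, so the origin precedes point
    $0$. *)
Definition pred_point p (i : nat) : R * R := if i is j.+1 then p j else (0, 0).

Definition link_cost a b p (i : nat) : R :=
  `|(p i).2 - (pred_point p i).2| `^ a / `|(p i).1 - (pred_point p i).1| `^ b.

(** Only the first [k] values of [p] count. With the order built into the sequence, truncation and
    measurability involve no sorting. *)
Definition chain a b B (k : nat) p : Prop :=
  (forall i, (i < k)%N -> (pred_point p i).1 < (p i).1) /\
  \sum_(i < k) link_cost a b p i <= B.

Lemma link_cost_ge0 a b p i : 0 <= link_cost a b p i.
Proof. by rewrite divr_ge0 ?powR_ge0. Qed.

Lemma chain_prefix a b B j k p : (j <= k)%N -> chain a b B k p -> chain a b B j p.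
Proof.
move=> jk [inc le]; split=> [i ij|]; first by rewrite inc ?(leq_trans ij).
apply: le_trans le; rewrite -(big_mkord xpredT (link_cost a b p)).
rewrite -[leRHS](big_mkord xpredT (link_cost a b p)).
rewrite (big_cat_nat (leq0n j) jk) /= lerDl sumr_ge0 // => i _.
exact: link_cost_ge0.
Qed.

Lemma chain_path (s : seq (plane R)) :
  path (fun u v : R => u < v) 0 [seq q.1 | q <- s] <->
  forall i, (i < size s)%N ->
    (pred_point (nth (0, 0) s) i).1 < (nth (0, 0) s i).1.
Proof.
split=> [/(pathP 0) + i si|H].
  rewrite size_map => /(_ i si); rewrite (nth_map (0, 0)) //.
  by case: i si => //= i si; rewrite (nth_map (0, 0)) // ltnW.
apply/(pathP 0) => i; rewrite size_map => si.
rewrite (nth_map (0, 0)) //; have := H i si.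
by case: i si => //= i si; rewrite (nth_map (0, 0)) // ltnW.
Qed.

Lemma chain_mkseq a b B k p : chain a b B k p ->
  path (fun u v : R => u < v) 0 [seq q.1 | q <- mkseq p k].
Proof.
case=> inc _; apply/chain_path => i; rewrite size_mkseq => ik.
rewrite nth_mkseq //; have := inc i ik.
by case: i ik => //= i ik; rewrite nth_mkseq // ltnW.
Qed.

Lemma chain_uniq a b B k p : chain a b B k p -> uniq (mkseq p k).
Proof. by move=> /chain_mkseq/path_sorted/lt_sorted_uniq/map_uniq. Qed.

Local Notation le_time := (fun p q : plane R => (p.1 : R) <= q.1).

(** A directed set has no ties in time, so sorting by the weak order on times already yields
    strictly increasing times. *)
Lemma time_sort_lt (D : {fset plane R}) :
  directed D -> path (fun u v : R => u < v) 0 [seq q.1 | q <- time_sort D].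
Proof.
case=> s sD ps.
have perm : perm_eq [seq q.1 | q <- time_sort D] [seq q.1 | q <- s].
  by apply: perm_map; rewrite perm_sort perm_sym.
have ss : sorted <%R [seq q.1 | q <- s] by exact: path_sorted ps.
rewrite path_min_sorted; last first.
  by rewrite (perm_all _ perm); exact: (order_path_min lt_trans ps).
rewrite lt_sorted_uniq_le (perm_uniq perm) (lt_sorted_uniq ss) /=.
by rewrite sorted_map; apply: sort_sorted => u v; exact: le_total.
Qed.

(** Distinct times make the comparison of times antisymmetric on the points of [D], and a sorted
    list is then unique. *)
Lemma time_sort_path (D : {fset plane R}) (s : seq (plane R)) :
  perm_eq s D -> path (fun u v : R => u < v) 0 [seq q.1 | q <- s] ->
  time_sort D = s.
Proof.
move=> sD ps; have ss : sorted <%R [seq q.1 | q <- s] by exact: path_sorted ps.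
have pp : perm_eq (time_sort D) s by rewrite perm_sort perm_sym.
apply: (@sorted_eq_in _ le_time).
- by move=> u v w _ _ _; exact: le_trans.
- move=> u v; rewrite !(perm_mem pp) => /(nthP (0, 0))[i si <-].
  move=> /(nthP (0, 0))[j sj <-] /le_anti; rewrite -!(nth_map _ 0)// => /eqP.
  by rewrite nth_uniq ?size_map ?(lt_sorted_uniq ss) // => /eqP ->.
- by apply: sort_sorted => u v; exact: le_total.
- by move: ss; rewrite lt_sorted_uniq_le => /andP[_]; rewrite sorted_map.
- exact: pp.
Qed.

Lemma entropyE a b (D : {fset plane R}) :
  entropy a b D = \sum_(i < #|` D|) link_cost a b (nth (0, 0) (time_sort D)) i.
Proof.
rewrite /entropy big_add1 /= big_mkord; apply: eq_bigr => -[[|i] iD] _ //=.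
Qed.

End Chains.

(** * Last passage as existence of a chain of sample indices *)

Section LastPassage.
Context {R : realType} (Omega : Type) (Z : nat -> Omega -> plane R).

(** Turns the maximum over subsets into a finite union over index tuples, ready for measurability
    and a union bound. For [k = 0] the empty chain costs $0\le B$. *)
Lemma lpp_geP (a b B : R) (m : nat) (w : Omega) k : 0 <= B ->
  (k <= entropy_lpp Z a b B m w)%N <->
  exists s : k.-tuple 'I_m,
    chain a b B k (fun i => Z (nth 0 [seq val j | j <- s] i) w).
Proof.
move=> B0; split=> [|[s ch]]; last first.
  have [inc le] := ch.
  pose p i := Z (nth 0 [seq val j | j <- s] i) w.
  have nq i : (i < k)%N -> nth (0, 0) (mkseq p k) i = p i by exact: nth_mkseq.
  have ps := chain_mkseq ch.
  have us : uniq (mkseq p k) := chain_uniq ch.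
  (* The points of a chain are distinct, so this set has exactly [k] elements. *)
  pose D := [fset q in mkseq p k]%fset.
  have sD : perm_eq (mkseq p k) D.
    by apply: uniq_perm => // [|q]; rewrite ?fset_uniq // !inE.
  have cD : #|` D| = k by rewrite -(perm_size sD) size_mkseq.
  rewrite /entropy_lpp /last_passage -{1}cD.
  apply: leq_bigmax_seq.
    rewrite fpowersetE; apply/fsubsetP => q; rewrite !inE => /mapP[i].
    rewrite mem_iota add0n => /andP[_ ik] ->; apply/imfsetP => /=.
    exists (nth 0 [seq val j | j <- s] i) => //.
    have j0 : 'I_m by exact: (tnth s (Ordinal ik)).
    rewrite mem_iota /= add0n (nth_map j0) ?size_tuple //.
  apply/asboolP; split; first by exists (mkseq p k).
  rewrite entropyE cD (time_sort_path sD ps); apply: le_trans le.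
  apply: ler_sum => -[i ik] _ /=; rewrite /link_cost nq //.
  by case: i ik => //= i ik; rewrite nq // ltnW.
case: k => [_|k kL].
  exists [tuple]; split => //; by rewrite big_ord0.
have [D [Dsub DE kD]] : exists D, [/\ D \in fpowerset (sample Z m w),
    entropy_class a b B D & (k < #|` D|)%N].
  apply: contrapT => H; move: kL; rewrite ltnNge => /negP; apply.
  apply/bigmax_leqP_seq => D Dsub /asboolP DE; rewrite leqNgt.
  by apply/negP => kD; apply: H; exists D.
case: DE => dD eD.
have pD := time_sort_lt dD.
have sz : size (time_sort D) = #|` D| by rewrite size_sort.
(* Beyond the last point of [D] any index serves; one exists because [D] is a nonempty subset of the
   sample. *)
have idx i : exists j : 'I_m, (i < #|` D|)%N -> Z j w = nth (0, 0) (time_sort D) i.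
  case: (ltnP i #|` D|) => iD; last first.
    have : nth (0,0) (time_sort D) 0 \in sample Z m w.
      move: Dsub; rewrite fpowersetE => /fsubsetP; apply.
      rewrite -(mem_sort (fun p q : plane R => p.1 <= q.1)) mem_nth // sz.
      exact: leq_ltn_trans kD.
    case/imfsetP => j /=; rewrite mem_iota add0n => /= jm _.
    by exists (Ordinal jm).
  have : nth (0,0) (time_sort D) i \in sample Z m w.
    move: Dsub; rewrite fpowersetE => /fsubsetP; apply.
    by rewrite -(mem_sort (fun p q : plane R => p.1 <= q.1)) mem_nth // sz.
  case/imfsetP => j /=; rewrite mem_iota add0n => /= jm ->.
  by exists (Ordinal jm).
have [f fP] := choice idx.
exists [tuple f i | i < k.+1].
have pE i : (i < k.+1)%N -> Z (nth 0 [seq val j | j <- [tuple f i | i < k.+1]] i) w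
    = nth (0, 0) (time_sort D) i.
  move=> ik; rewrite (nth_map (f 0)) ?size_tuple //.
  rewrite -[i]/(val (Ordinal ik)) -tnth_nth tnth_mktuple /= fP //.
  exact: leq_trans kD.
(* All of [D] in time order is a chain; its first [k.+1] points are kept. *)
have : chain a b B k.+1 (nth (0, 0) (time_sort D)).
  apply: (@chain_prefix _ _ _ _ _ #|` D|) => //.
  split; last by rewrite -entropyE.
  by rewrite -sz; apply/chain_path.
case=> inc le; split=> [i ik|].
  rewrite pE //; have := inc i ik.
  by case: i ik => //= i ik; rewrite pE // ltnW.
apply: le_trans le; apply: ler_sum => -[i ik] _ /=; rewrite /link_cost pE //.
by case: i ik => //= i ik; rewrite pE // ltnW.
Qed.

End LastPassage.

(** * Measurability and a finite union bound *)

Section Events.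
Context d (Omega : measurableType d) (R : realType) (P : probability Omega R).

Lemma bool_event (f : Omega -> bool) :
  measurable_fun [set: Omega] f -> measurable [set w | f w].
Proof.
by move=> mf; rewrite -[X in measurable X]setTI; exact: (mf _ [set true]).
Qed.

Lemma measurable_forall (I : finType) (F : I -> set Omega) :
  (forall i, measurable (F i)) -> measurable [set w | forall i, F i w].
Proof.
move=> mF; rewrite [X in measurable X](_ : _ = \bigcap_(i in [set: I]) F i).
  by apply: fin_bigcap_measurable.
by apply/seteqP; split=> w H i => [_|]; apply: H.
Qed.

(** The null set [N] absorbs outcomes that the events [F i] fail to cover; only indices satisfying
    [Q] are counted. *)
Lemma finite_union_bound (I : finType) (Q : pred I) (F : I -> set Omega)
    (E N : set Omega) (c : R) :
  measurable E -> measurable N -> P N = 0%E ->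
  (forall i, Q i -> measurable (F i)) ->
  (forall i, Q i -> (P (F i) <= c%:E)%E) ->
  (forall w, E w -> ~ N w -> exists2 i, Q i & F i w) ->
  (P E <= (#|Q|%:R * c)%:E)%E.
Proof.
move=> mE mN PN mF PF EF.
have mU : measurable (\big[setU/set0]_(i | Q i) F i).
  by apply: bigsetU_measurable => i; exact: mF.
have sub : E `<=` N `|` \big[setU/set0]_(i | Q i) F i.
  move=> w Ew; case: (pselect (N w)) => [Nw|Nw]; [by left|right].
  by have [i Qi Fi] := EF w Ew Nw; rewrite (bigD1 i)//=; left.
apply: (@le_trans _ _ (P (N `|` \big[setU/set0]_(i | Q i) F i))).
  by rewrite le_measure ?inE //; exact: measurableU.
apply: le_trans (measureU2 _ mN mU) _.
rewrite [X in (X + _ <= _)%E]PN add0e.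
rewrite mulr_natl -sumr_const -sumEFin.
(* Measurability is carried through the induction because subadditivity requires it of each partial
   union. *)
have [//] : measurable (\big[setU/set0]_(i | Q i) F i) /\
    (P (\big[setU/set0]_(i | Q i) F i) <= \sum_(i in Q) c%:E)%E.
elim/big_rec2 : _ => [|i X Y Qi [mX IH]]; first by rewrite measure0.
split; first by apply: measurableU => //; exact: mF.
apply: le_trans (measureU2 _ (mF _ Qi) mX) _.
by apply: leeD => //; exact: PF.
Qed.

End Events.

(** * Sample points: measurability, independence and the uniform law *)

Section Independence.
Context d (Omega : measurableType d) (R : realType) (P : probability Omega R).
Context (Z : nat -> {RV P >-> plane R}).

Lemma measurable_RV i (A : set (plane R)) : measurable A -> measurable (Z i @^-1` A).
Proof. by move=> mA; rewrite -[X in measurable X]setTI; exact: measurable_funP. Qed.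

Lemma measurable_chain a b B k (f : nat -> nat) :
  measurable [set w | chain a b B k (fun i => Z (f i) w)].
Proof.
have m1 i : measurable_fun [set: Omega] (fun w => (Z i w).1 : measurableTypeR R).
  exact: measurableT_comp.
have m2 i : measurable_fun [set: Omega] (fun w => (Z i w).2 : measurableTypeR R).
  exact: measurableT_comp.
have p1 i : measurable_fun [set: Omega]
    (fun w => (pred_point (fun i => Z (f i) w) i).1 : measurableTypeR R).
  by case: i => [|i] /=; [exact: measurable_cst | exact: m1].
have p2 i : measurable_fun [set: Omega]
    (fun w => (pred_point (fun i => Z (f i) w) i).2 : measurableTypeR R).
  by case: i => [|i] /=; [exact: measurable_cst | exact: m2].
rewrite [X in measurable X](_ : _ =
  (\bigcap_(i in [set i | (i < k)%N])
     [set w | (pred_point (fun i => Z (f i) w) i).1 < (Z (f i) w).1]) `&`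
  [set w | \sum_(i < k) link_cost a b (fun i => Z (f i) w) i <= B]); last first.
  by apply/seteqP; split.
apply: measurableI.
  apply: bigcap_measurableType => i _; apply: bool_event.
  by apply: measurable_fun_ltr; [exact: p1|exact: m1].
apply: bool_event; apply: measurable_fun_ler => //.
apply: measurable_sum => i.
(* Dividing by a power becomes multiplying by the power with exponent $-b$, so products of
   measurable power functions suffice. *)
rewrite /link_cost; under eq_fun do rewrite -powRN.
apply: measurable_funM.
  apply: (measurableT_comp (measurable_powR a)).
  apply: measurableT_comp => //. by apply: measurable_funB; [exact: m2|exact: p2].
apply: (measurableT_comp (measurable_powR (- b))).
apply: measurableT_comp => //. by apply: measurable_funB; [exact: m1|exact: p1].
Qed.

(** Injectivity of [f] lets the family [C] be read as a family over the naturals, completed by the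
    whole plane off the range of [f]. *)
Lemma independent_event (I : finType) (f : I -> nat) (C : I -> set (plane R)) :
  mutually_independent Z -> injective f -> (forall i, measurable (C i)) ->
  P [set w | forall i, C i (Z (f i) w)] = (\prod_i P (Z (f i) @^-1` C i))%E.
Proof.
move=> indep f_inj mC.
pose A n := if [pick i | f i == n] is Some i then C i else setT.
have AE i : A (f i) = C i.
  rewrite /A; case: pickP => [j /eqP/f_inj ->//|/(_ i)]; by rewrite eqxx.
have mA n : measurable (A n) by rewrite /A; case: pickP.
pose J := [fset f i | i in I]%fset.
have /= := indep J A (fun n _ => mA n).
rewrite big_imfset /=; last by move=> i j _ _; exact: f_inj.
rewrite big_enum /=; under eq_bigr do rewrite AE.
move=> <-; congr (P _); apply/seteqP; split=> [w H n /= /imfsetP[i _ ->]|w H i].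
  by rewrite /preimage /= AE.
by have := H (f i); rewrite /preimage /= AE; apply; apply/imfsetP; exists i.
Qed.

Section Uniform.
Context (t x : R).
Hypotheses (t0 : 0 < t) (x0 : 0 < x).
Hypothesis unif : forall i, uniform_on plane_measure (box t x) (Z i).

Lemma plane_measureX (A1 A2 : set R) :
  measurable (A1 : set (measurableTypeR R)) ->
  measurable (A2 : set (measurableTypeR R)) ->
  @plane_measure R (A1 `*` A2) = (lebesgue_measure A1 * lebesgue_measure A2)%E.
Proof. by move=> m1 m2; exact: product_measure1E. Qed.

Lemma measurable_box : measurable (box t x).
Proof. by apply: measurableX; exact: measurable_itv. Qed.

Lemma box_mass : plane_measure (box t x) = (2 * t * x)%:E.
Proof.
rewrite plane_measureX; [|exact: measurable_itv..].
rewrite !lebesgue_measure_itv /= !lte_fin t0 gtrN //.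
by rewrite -!EFinB -EFinM; congr EFin; lra.
Qed.

Lemma uniformE i A : measurable A ->
  P (Z i @^-1` A) = (plane_measure (A `&` box t x) * ((2 * t * x)^-1)%:E)%E.
Proof. by move=> mA; have := unif i mA; rewrite box_mass. Qed.

(** Only an inequality, since grid cells may stick out of the box. *)
Lemma uniform_le i A r : measurable A -> (plane_measure A <= r%:E)%E ->
  (P (Z i @^-1` A) <= (r / (2 * t * x))%:E)%E.
Proof.
move=> mA Ar; rewrite uniformE // EFinM lee_wpmul2r //.
  by rewrite lee_fin invr_ge0 !mulr_ge0 ?ltW.
apply: le_trans Ar; apply: le_measure; rewrite ?inE //.
exact: measurableI measurable_box.
Qed.

(** Exact for sets inside the box, which is what passing to the complement of the slots needs. *)
Lemma uniform_sub i A r : measurable A -> A `<=` box t x ->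
  plane_measure A = r%:E -> P (Z i @^-1` A) = (r / (2 * t * x))%:E.
Proof. by move=> mA /setIidPl AB Ar; rewrite uniformE // AB Ar. Qed.

Lemma uniform_out i : P (Z i @^-1` (~` box t x)) = 0%E.
Proof.
rewrite uniformE; last exact: measurableC measurable_box.
by rewrite setICl measure0 mul0e.
Qed.

End Uniform.
End Independence.
Lemma powR_ge1 (R : realType) (x c : R) : 1 <= x -> 0 <= c -> 1 <= x `^ c.
Proof. by move=> x1 c0; rewrite -[leLHS](powRr0 x) ler_powR. Qed.

(** * Grid cells visited by a chain, and their count *)

Section Discretization.
Context {R : realType}.
Variables (a b : R).
Hypotheses (a0 : 0 < a) (b0 : 0 <= b).

(** Bounds, in units of the spatial mesh, the displacement of a link with rounded cost [l] and time
    rise [n]; the successors undo rounding down. *)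
Definition spread (l n : nat) : R := l.+1%:R `^ (1 / a) * n.+1%:R `^ (b / a).

Definition reach (l n : nat) : nat := (Num.truncn (spread l n)).+1.

(** A common bound on all shifts, which makes the steps a finite type. *)
Definition reach_bound (k : nat) : nat :=
  \max_(l < k.+1) \max_(n < k.+1) (2 * reach l n).

(* A step records the rise of the time index, the rounded cost of the link, and
   the increment of the space index shifted by [reach] to make it natural. *)
Definition step (k : nat) := ('I_k.+1 * 'I_k.+1 * 'I_(reach_bound k).+1)%type.

Definition rise k (e : step k) : nat := e.1.1.
Definition price k (e : step k) : nat := e.1.2.
Definition shift k (e : step k) : nat := e.2.

(** The rises sum to at most [k] as the box has height [k] in time meshes, and the prices as costs
    are measured in units of $B/k$. *)
Definition admissible k (g : {ffun 'I_k -> step k}) : bool :=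
  [&& (\sum_i rise (g i) <= k)%N, (\sum_i price (g i) <= k)%N &
     [forall i, (shift (g i) <= 2 * reach (price (g i)) (rise (g i)))%N]].

Let ia0 : 0 <= 1 / a.
Proof. by rewrite divr_ge0 // ltW. Qed.

Let ba0 : 0 <= b / a.
Proof. by rewrite divr_ge0 // ltW. Qed.

Lemma spread_ge1 l n : 1 <= spread l n.
Proof.
rewrite -[1]mulr1 ler_pM //.
- by rewrite powR_ge1 ?ler1n.
- by rewrite powR_ge1 ?ler1n.
Qed.

Lemma reach_le_bound k l n : (l <= k)%N -> (n <= k)%N ->
  (2 * reach l n <= reach_bound k)%N.
Proof.
move=> lk nk.
apply: leq_trans (leq_bigmax (Ordinal (lk : (l < k.+1)%N))).
exact: (leq_bigmax (Ordinal (nk : (n < k.+1)%N))).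
Qed.

Lemma sum_half_pow k : \sum_(i < k) (2^-1 : R) ^+ i <= 2.
Proof.
suff -> : \sum_(i < k) (2^-1 : R) ^+ i = 2 - 2 * 2^-1 ^+ k.
  by rewrite gerBl mulr_ge0 // exprn_ge0 // invr_ge0.
elim: k => [|k IH]; first by rewrite big_ord0 expr0; lra.
by rewrite big_ord_recr /= IH exprS; field.
Qed.

(* Bounding the indicator of [admissible] by a product of weights makes the
   count of admissible sequences factorize over the steps. *)
Definition weight k (e : step k) : R :=
  (shift e <= 2 * reach (price e) (rise e))%N%:R *
  (2^-1 ^+ rise e * 2^-1 ^+ price e / spread (price e) (rise e)).

(** The $2\,\mathrm{reach}+1$ shifts number at most 5 times the spread, which cancels the
    denominator; two geometric series, each at most $2$, leave $5\cdot 4=20$. *)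
Lemma sum_weight k : \sum_e @weight k e <= 20.
Proof.
rewrite -(pair_bigA _ (fun e1 e2 => @weight k (e1, e2))) /=.
rewrite -(pair_bigA _ (fun n l => \sum_d @weight k (n, l, d))) /=.
apply: (@le_trans _ _
  (\sum_(n < k.+1) \sum_(l < k.+1) 5 * (2^-1 ^+ n * 2^-1 ^+ l))).
  apply: ler_sum => n _; apply: ler_sum => l _.
  rewrite /weight /rise /price /shift /= -mulr_suml.
  have sp : 0 < spread l n by exact: lt_le_trans ltr01 (spread_ge1 l n).
  rewrite [leLHS]mulrCA [leRHS]mulrC ler_wpM2l ?mulr_ge0 ?exprn_ge0 ?invr_ge0 //.
  rewrite ler_pdivrMr //.
  have -> : \sum_(d < (reach_bound k).+1) ((d <= 2 * reach l n)%N%:R : R)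
      = (2 * reach l n).+1%:R.
    have le : ((2 * reach l n).+1 <= (reach_bound k).+1)%N.
      by rewrite ltnS reach_le_bound // -ltnS.
    rewrite [RHS](_ : _ = \sum_(d < (2 * reach l n).+1) 1); last first.
      by rewrite sumr_const card_ord.
    rewrite (big_ord_widen _ (fun=> 1) le) [RHS]big_mkcond /=.
    by apply: eq_bigr => d _; rewrite ltnS; case: leqP.
  have := spread_ge1 l n.
  have : (Num.truncn (spread l n))%:R <= spread l n by rewrite truncn_le ltW.
  rewrite /reach; set T := Num.truncn _ => h1 h2.
  rewrite -addn1 natrD natrM -addn1 natrD; lra.
under eq_bigr => n _ do rewrite -mulr_sumr -mulr_sumr.
rewrite -mulr_sumr -mulr_suml.
have h := sum_half_pow k.+1.
have h0 : 0 <= \sum_(i < k.+1) (2^-1 : R) ^+ i.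
  by rewrite sumr_ge0 // => i _; rewrite exprn_ge0 // invr_ge0.
by nra.
Qed.

(** By $j+1\le 2^j$, the product of the spreads along a sequence is controlled by the total rise and
    the total price alone. *)
Lemma spread_le l n :
  spread l n <= (2 `^ (1 / a)) ^+ l * (2 `^ (b / a)) ^+ n.
Proof.
have H c j : 0 <= c -> j.+1%:R `^ c <= (2 `^ c) ^+ j :> R.
  move=> c0; rewrite -[_ ^+ j]powR_mulrn ?powR_ge0 // powRAC.
  rewrite ge0_ler_powR ?nnegrE ?powR_ge0 // powR_mulrn //.
  by rewrite -natrX ler_nat ltn_expl.
by rewrite ler_pM ?powR_ge0 // H.
Qed.

(** With $c=2^{(1+b)/a}$, each admissible sequence has weight product at least $(4c)^{-k}$, while
    the products over all sequences sum to at most $20^k$; hence $(80c)^k$. *)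
Lemma card_admissible k :
  #|@admissible k|%:R <= (80 * 2 `^ ((1 + b) / a)) ^+ k :> R.
Proof.
set c := 2 `^ ((1 + b) / a).
have two c' : 0 < 2 `^ c' :> R by rewrite powR_gt0.
have two1 c' : 0 <= c' -> 1 <= 2 `^ c' :> R.
  by apply: powR_ge1; rewrite ler1n.
have cE : c = 2 `^ (1 / a) * 2 `^ (b / a).
  by rewrite -powRD ?pnatr_eq0 ?implybT // -mulrDl.
have one (g : {ffun 'I_k -> step k}) : admissible g ->
    1 <= (4 * c) ^+ k * \prod_i weight (g i).
  move=> /and3P[sn sl /forallP sd].
  rewrite -ler_pdivrMl ?exprn_gt0 ?mulr_gt0 //; last exact: two.
  (* The least contribution to the weight per unit of rise and per unit of price; their product is
     $1/(4c)$. *)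
  pose al := 2^-1 * (2 `^ (b / a))^-1 : R; pose be := 2^-1 * (2 `^ (1 / a))^-1 : R.
  have al0 : 0 < al by rewrite mulr_gt0 // invr_gt0.
  have be0 : 0 < be by rewrite mulr_gt0 // invr_gt0.
  have al1 : al <= 1.
    by rewrite mulr_ile1 ?invr_ge0 ?powR_ge0 ?invf_le1 ?two1 ?ler1n.
  have be1 : be <= 1.
    by rewrite mulr_ile1 ?invr_ge0 ?powR_ge0 ?invf_le1 ?two1 ?ler1n.
  apply: (@le_trans _ _ (al ^+ (\sum_i rise (g i)) * be ^+ (\sum_i price (g i)))).
    have -> : ((4 * c) ^+ k)^-1 * 1 = al ^+ k * be ^+ k.
      rewrite mulr1 -exprVn -exprMn cE; congr (_ ^+ k).
      rewrite /al /be !invfM; lra.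
    (* Both bases are at most $1$ and both totals at most [k]. *)
    by apply: ler_pM; rewrite ?exprn_ge0 ?(ltW al0) ?(ltW be0) //;
      apply: ler_wiXn2l; rewrite ?(ltW al0) ?(ltW be0) //.
  rewrite -!prodrXr -big_split /=; apply: ler_prod => i _.
  rewrite mulr_ge0 ?exprn_ge0 ?(ltW al0) ?(ltW be0) //=.
  rewrite /weight sd mul1r !exprMn mulrACA.
  rewrite ler_wpM2l ?mulr_ge0 ?exprn_ge0 ?invr_ge0 //.
  rewrite mulrC !exprVn -invfM lef_pV2 ?posrE ?spread_le //.
    by rewrite mulr_gt0 // exprn_gt0.
rewrite -sum1_card natr_sum.
apply: (@le_trans _ _
    (\sum_(g : {ffun 'I_k -> step k}) (4 * c) ^+ k * \prod_i weight (g i))).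
  rewrite [leLHS]big_mkcond; apply: ler_sum => g _.
  case: ifPn => [/one//|_]; rewrite mulr_ge0 ?exprn_ge0 ?mulr_ge0 ?(ltW (two _)) //.
  apply: prodr_ge0 => i _; rewrite mulr_ge0 // divr_ge0 ?mulr_ge0 ?exprn_ge0 ?invr_ge0 //.
(* A sum over sequences of products over steps is the [k]-th power of the sum over one step. *)
rewrite -mulr_sumr -(bigA_distr_bigA (fun (i : 'I_k) e => weight e)) /=.
rewrite prodr_const card_ord -exprMn.
rewrite lerXn2r ?nnegrE ?mulr_ge0 ?(ltW (two _)) //.
  apply: sumr_ge0 => e _; rewrite mulr_ge0 // divr_ge0 ?mulr_ge0 ?exprn_ge0 ?invr_ge0 //.
have := sum_weight k; have := two ((1 + b) / a); rewrite -/c; nra.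
Qed.

Definition time_index k (g : {ffun 'I_k -> step k}) (i : nat) : int :=
  \sum_(j < k | (j <= i)%N) (rise (g j))%:Z.

(** Partial sums of the increments, with the shift by [reach] undone; indices may be negative. *)
Definition space_index k (g : {ffun 'I_k -> step k}) (i : nat) : int :=
  \sum_(j < k | (j <= i)%N)
    ((shift (g j))%:Z - (reach (price (g j)) (rise (g j)))%:Z).

Definition cell (dt dx : R) (u v : int) : set (plane R) :=
  `[u%:~R * dt, (u + 1)%:~R * dt[ `*` `[v%:~R * dx, (v + 1)%:~R * dx[.

Lemma telescope_index k (V : nat -> int) (i : 'I_k) : V 0 = 0 ->
  \sum_(j < k | (j <= i)%N) (V j.+1 - V j) = V i.+1.
Proof.
move=> V0; transitivity (V i.+1 - V 0%N); last by rewrite V0 subr0.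
rewrite -telescope_sumr // big_mkord.
by rewrite (big_ord_widen _ (fun j => V j.+1 - V j) (ltn_ord i)).
Qed.

Lemma floor_cell (y dy : R) : 0 < dy ->
  (Num.floor (y / dy))%:~R * dy <= y < (Num.floor (y / dy) + 1)%:~R * dy.
Proof.
move=> dy0; have /andP[h1 h2] := floor_itv (y / dy).
by rewrite -ler_pdivlMr // h1 -ltr_pdivrMr.
Qed.

(** Taking floors changes a difference by less than $1$, so the integer on the left is below
    $\lfloor r\rfloor+2$. *)
Lemma floor_diff_le (y z r : R) : `|y - z| <= r ->
  (`|Num.floor y - Num.floor z| <= (Num.truncn r).+1)%N.
Proof.
move=> yz; have /andP[y1 y2] := floor_itv y; have /andP[z1 z2] := floor_itv z.
have r2 := truncnS_gt r.
rewrite -ltnS -(ltr_nat R) natr_absz intr_norm intrD rmorphN /=.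
rewrite intrD in y2; rewrite intrD in z2.
move: yz; rewrite ler_norml => /andP[l1 l2].
rewrite -[_.+2]addn1 natrD ltr_norml; rewrite ?mulr1z in y2 z2; apply/andP; split; lra.
Qed.

(** The $a$-th power of the displacement is the cost times the $b$-th power of the time gap, so at
    most $(l+1)(B/k)((n+1)\,dt)^b$; then take the $a$-th root. *)
Lemma link_spread (B dt k : R) (p : nat -> plane R) (i l n : nat) :
  0 < B -> 0 < k -> 0 < dt ->
  (pred_point p i).1 < (p i).1 ->
  (p i).1 - (pred_point p i).1 <= n.+1%:R * dt ->
  k * link_cost a b p i / B <= l.+1%:R ->
  `|(p i).2 - (pred_point p i).2| / (B / k * dt `^ b) `^ (1 / a) <= spread l n.
Proof.
move=> B0 k0 dt0 inc sn cl.
set y := `|_|; set eta := B / k * dt `^ b.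
have eta0 : 0 < eta by rewrite mulr_gt0 ?divr_gt0 ?powR_gt0.
have y0 : 0 <= y by exact: normr_ge0.
have yE : y = (y `^ a) `^ (1 / a).
  by rewrite -powRrM mulrC divfK ?gt_eqF // powRr1.
have s0 : 0 < (p i).1 - (pred_point p i).1 by rewrite subr_gt0.
have ya : y `^ a <= (l.+1%:R * n.+1%:R `^ b) * eta.
  have -> : y `^ a = link_cost a b p i * `|(p i).1 - (pred_point p i).1| `^ b.
    by rewrite /link_cost divfK // gt_eqF // powR_gt0 // normr_gt0 gt_eqF.
  have -> : l.+1%:R * n.+1%:R `^ b * eta
      = (l.+1%:R * B / k) * (n.+1%:R * dt) `^ b.
    by rewrite powRM ?(ltW dt0) // /eta; ring.
  rewrite ler_pM ?link_cost_ge0 ?powR_ge0 //.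
    by move: cl; rewrite ler_pdivrMr // ler_pdivlMr // mulrC.
  rewrite gtr0_norm // ge0_ler_powR // nnegrE ?(ltW s0) //.
  by rewrite mulr_ge0 // ltW.
rewrite ler_pdivrMr ?powR_gt0 // yE.
apply: (@le_trans _ _ ((l.+1%:R * n.+1%:R `^ b * eta) `^ (1 / a))).
  apply: ge0_ler_powR => //; rewrite nnegrE ?powR_ge0 //.
  by rewrite mulr_ge0 ?(ltW eta0) // mulr_ge0 ?powR_ge0.
have eta_ge0 := ltW eta0.
rewrite [leLHS]powRM //.
by rewrite powRM ?powR_ge0 // -powRrM mulrA mulr1.
Qed.

Lemma chain_cells (B t x : R) (k : nat) (p : nat -> plane R) :
  0 < B -> 0 < t -> (0 < k)%N -> chain a b B k p ->
  (forall i, (i < k)%N -> box t x (p i)) ->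
  exists2 g : {ffun 'I_k -> step k}, admissible g &
    forall i : 'I_k, cell (t / k%:R) ((B / k%:R * (t / k%:R) `^ b) `^ (1 / a))
      (time_index g i) (space_index g i) (p i).
Proof.
move=> B0 t0 k_gt0 [inc cost] inbox.
have k0 : 0 < k%:R :> R by rewrite ltr0n.
set dt := t / k%:R; set dx := _ `^ (1 / a).
have dt0 : 0 < dt by rewrite divr_gt0.
have dx0 : 0 < dx by rewrite powR_gt0 // mulr_gt0 ?powR_gt0 ?divr_gt0.
(* Grid indices of the predecessor: [U i.+1] and [V i.+1] locate [p i], and both sequences start at
   $0$. *)
pose U (i : nat) : nat := Num.truncn ((pred_point p i).1 / dt).
pose V (i : nat) : int := Num.floor ((pred_point p i).2 / dx).
have pos i : (i <= k)%N -> 0 <= (pred_point p i).1.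
  by case: i => //= i ik; have [] := inbox i ik; rewrite /= in_itv /= => /andP[].
have U0 : U 0%N = 0%N by rewrite /U /= mul0r truncn0.
have V0 : V 0%N = 0 by rewrite /V /= mul0r floor0.
have Uk i : (i <= k)%N -> (U i <= k)%N.
  case: i => [|i] ik; first by rewrite U0.
  rewrite truncn_le_nat ltr_pdivrMr //= /dt.
  have [] := inbox i ik; rewrite /= in_itv /= => /andP[_ h] _.
  by rewrite -addn1 natrD mulrDl mul1r -/dt mulrC divfK ?gt_eqF // ltr_pwDr.
have Umono i : (i < k)%N -> (U i <= U i.+1)%N.
  by move=> ik; rewrite le_truncn // ler_pM2r ?invr_gt0 // ltW // inc.
have cost1 i : (i < k)%N -> link_cost a b p i <= B.
  move=> ik; apply: le_trans cost; rewrite (bigD1 (Ordinal ik)) //=.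
  by rewrite lerDl sumr_ge0 // => j _; exact: link_cost_ge0.
(* The link cost in units of $B/k$, rounded down. *)
pose L i : nat := Num.truncn (k%:R * link_cost a b p i / B).
have Lk i : (i < k)%N -> (L i <= k)%N.
  move=> ik; rewrite truncn_le_nat ltr_pdivrMr //.
  rewrite -addn1 natrD mulrDl mul1r ltr_pwDr //.
  by rewrite ler_pM2l // cost1.
have step_reach i : (i < k)%N ->
    (`|V i.+1 - V i| <= reach (L i) (U i.+1 - U i))%N.
  move=> ik; apply: floor_diff_le; rewrite -mulrBl normrM.
  rewrite [X in _ * X]gtr0_norm ?invr_gt0 //.
  apply: link_spread => //; first exact: inc.
    have /andP[u1 _] : (U i)%:R <= (pred_point p i).1 / dt < (U i).+1%:R.
      by rewrite truncn_itv // divr_ge0 ?pos ?(ltnW ik) // ltW.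
    have u2 : (p i).1 / dt < (U i.+1).+1%:R by exact: truncnS_gt.
    rewrite -ler_pdivrMr // mulrBl -subSn ?Umono // natrB; last first.
      by apply: leqW; exact: Umono.
    by rewrite lerB // ltW.
  by rewrite ltW // truncnS_gt.
pose n i : nat := (U i.+1 - U i)%N.
(* The absolute value only converts to [nat]: [step_reach] makes the shifted increment
   nonnegative. *)
pose e i : nat := `|(V i.+1 - V i + (reach (L i) (n i))%:Z)%R|%N.
have eE i : (i < k)%N -> (e i)%:Z = V i.+1 - V i + (reach (L i) (n i))%:Z.
  by move=> /step_reach; rewrite -/(n i) /e; lia.
have e2 i : (i < k)%N -> (e i <= 2 * reach (L i) (n i))%N.
  by move=> ik; have := step_reach i ik; have := eE i ik; rewrite -/(n i); lia.
have nk i : (i < k)%N -> (n i <= k)%N.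
  by move=> ik; rewrite (leq_trans (leq_subr _ _)) // Uk.
pose g : {ffun 'I_k -> step k} := [ffun i : 'I_k =>
  (inord (n i), inord (L i), inord (e i))].
have gn i : rise (g i) = n i by rewrite ffunE /rise /= inordK // ltnS nk.
have gl i : price (g i) = L i by rewrite ffunE /price /= inordK // ltnS Lk.
have ge i : shift (g i) = e i.
  rewrite ffunE /shift /= inordK // ltnS (leq_trans (e2 _ _)) //.
  by rewrite reach_le_bound ?Lk ?nk.
have nE i : (i < k)%N -> (n i)%:Z = (U i.+1)%:Z - (U i)%:Z.
  by move=> ik; rewrite subzn // Umono.
have tE (i : 'I_k) : time_index g i = (U i.+1)%:Z.
  rewrite /time_index -[RHS](@telescope_index k (fun i => (U i)%:Z)) ?U0 //.
  by apply: eq_bigr => j _; rewrite gn nE.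
have sE (i : 'I_k) : space_index g i = V i.+1.
  rewrite /space_index -[RHS](@telescope_index k V) //.
  by apply: eq_bigr => j _; rewrite gn gl ge eE // addrK.
exists g => [|i]; last first.
  rewrite tE sE; split; rewrite /= in_itv /=; last exact: floor_cell.
  have /andP[h1 h2] : (U i.+1)%:R <= (p i).1 / dt < (U i.+1).+1%:R.
    by rewrite /U /= truncn_itv // divr_ge0 ?(ltW dt0) // (pos i.+1).
  have -> : ((U i.+1)%:Z + 1)%:~R = (U i.+1).+1%:R :> R by rewrite intrD -[in RHS]natr1.
  by rewrite -ler_pdivlMr // h1 -ltr_pdivrMr.
apply/and3P; split.
(* The rises telescope to [U k]. *)
- rewrite -(ler_nat R) natr_sum.
  under eq_bigr => i _ do rewrite gn natrB ?Umono //.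
  rewrite -(big_mkord xpredT (fun i => (U i.+1)%:R - (U i)%:R : R)).
  by rewrite telescope_sumr // U0 subr0 ler_nat Uk.
(* Rounding down bounds the total price by $k/B$ times the entropy. *)
- rewrite -(ler_nat R) natr_sum.
  apply: (@le_trans _ _ (\sum_(i < k) k%:R / B * link_cost a b p i)).
    apply: ler_sum => i _; rewrite gl mulrAC truncn_le.
    by rewrite !mulr_ge0 ?link_cost_ge0 ?invr_ge0 // ltW.
  by rewrite -mulr_sumr mulrAC ler_pdivrMr // ler_pM2l.
- by apply/forallP => i; rewrite gn gl ge e2.
Qed.

End Discretization.
Lemma powR_divr (R : realType) (x y c : R) : 0 <= x -> 0 < y ->
  (x / y) `^ c = x `^ c / y `^ c.
Proof.
move=> x0 y0; rewrite powRM ?invr_ge0 ?(ltW y0) //; congr (_ * _).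
by rewrite -powR_inv1 ?(ltW y0) // powRAC powR_inv1 // powR_ge0.
Qed.

Lemma powR_root (R : realType) (x a : R) : 0 < a -> 0 <= x ->
  (x `^ a) `^ (1 / a) = x.
Proof. by move=> a0 x0; rewrite -powRrM mulrC divfK ?gt_eqF // powRr1. Qed.

Lemma lee_prod_ge0 (R : realType) (I : finType) (f g : I -> \bar R) :
  (forall i, 0 <= f i)%E -> (forall i, f i <= g i)%E ->
  (\prod_i f i <= \prod_i g i)%E.
Proof.
move=> f0 fg.
have [//] : (0 <= \prod_i f i)%E /\ (\prod_i f i <= \prod_i g i)%E.
elim/big_ind2: _ => [|u1 v1 u2 v2 [? ?] [? ?]|i _]; split=> //.
  exact: mule_ge0.
exact: lee_pmul.
Qed.

(** * Upper tail by a union over indices and cells *)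

Section UpperTail.
Context d (Omega : measurableType d) (R : realType) (P : probability Omega R).
Context (Z : nat -> {RV P >-> plane R}).
Variables (a b t x B : R).
Hypotheses (a0 : 0 < a) (b0 : 0 <= b) (t0 : 0 < t) (x0 : 0 < x) (B0 : 0 < B).

Lemma measurable_lpp_ge k m :
  measurable [set w | (k <= entropy_lpp Z a b B m w)%N].
Proof.
rewrite [X in measurable X](_ : _ = \bigcup_(s in [set: k.-tuple 'I_m])
    [set w | chain a b B k (fun i => Z (nth 0%N [seq val j | j <- s] i) w)]).
  apply: fin_bigcup_measurable => // s _.
  exact: (measurable_chain _ _ _ _ _ (nth 0%N [seq val j | j <- s])).
apply/seteqP; split=> w /=.
  by move/(lpp_geP _ _ _ _ _ _ (ltW B0)) => [s H]; exists s.
by case=> s _ H; apply/(lpp_geP _ _ _ _ _ _ (ltW B0)); exists s.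
Qed.

Lemma measurable_lpp_le k m :
  measurable [set w | (entropy_lpp Z a b B m w <= k)%N].
Proof.
rewrite [X in measurable X](_ : _ =
  ~` [set w | (k.+1 <= entropy_lpp Z a b B m w)%N]).
  exact/measurableC/measurable_lpp_ge.
by apply/seteqP; split=> w /=; [rewrite leqNgt => /negP|move/negP; rewrite -leqNgt].
Qed.

Lemma measurable_cell (dt dx : R) (u v : int) : measurable (cell dt dx u v).
Proof. by apply: measurableX; exact: measurable_itv. Qed.

Lemma cell_mass (dt dx : R) (u v : int) : 0 < dt -> 0 < dx ->
  plane_measure (cell dt dx u v) = (dt * dx)%:E.
Proof.
move=> dt0 dx0; rewrite plane_measureX; [|exact: measurable_itv..].
rewrite !lebesgue_measure_itv /= !lte_fin !intrD !mulrDl !mul1r.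
by rewrite !ltrDl dt0 dx0 -!EFinB -EFinM; congr EFin; ring.
Qed.

Hypothesis indep : mutually_independent Z.
Hypothesis unif : forall i, uniform_on plane_measure (box t x) (Z i).

(** There are at most $m^k$ index tuples and $(80\cdot 2^{(1+b)/a})^k$ cell sequences, and each pair
    has probability at most $q^k$, with [q] the mass of a cell relative to the box. The $2$ in the
    box mass turns $80$ into $40$. *)
Lemma lpp_upper_tail k m : (0 < k)%N ->
  (P [set w | (k <= entropy_lpp Z a b B m w)%N] <=
    ((40 * 2 `^ ((1 + b) / a) * (B * t `^ b / x `^ a) `^ (1 / a) * m%:R /
       k%:R `^ ((a + b + 1) / a)) ^+ k)%:E)%E.
Proof.
move=> k_gt0; have k0 : 0 < k%:R :> R by rewrite ltr0n.
set dt := t / k%:R; set dx := (B / k%:R * dt `^ b) `^ (1 / a).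
have dt0 : 0 < dt by rewrite divr_gt0.
have dx0 : 0 < dx by rewrite powR_gt0 // mulr_gt0 ?powR_gt0 ?divr_gt0.
pose q := dt * dx / (2 * t * x).
have q0 : 0 <= q by apply: divr_ge0; apply: ltW; [exact: mulr_gt0|rewrite !mulr_gt0].
pose Q (h : k.-tuple 'I_m * {ffun 'I_k -> step a b k}) :=
  uniq h.1 && admissible h.2.
pose F (h : k.-tuple 'I_m * {ffun 'I_k -> step a b k}) := [set w |
  forall i : 'I_k, cell dt dx (time_index h.2 i) (space_index h.2 i)
    (Z (tnth h.1 i) w)].
pose N := \bigcup_(i in [set: 'I_m]) (Z i @^-1` (~` box t x)).
have mout i : measurable (Z i @^-1` (~` box t x)).
  by apply: measurable_RV; apply: measurableC; exact: measurable_box.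
have mN : measurable N by apply: fin_bigcup_measurable => // i _; exact: mout.
have PN : P N = 0%E.
  apply/eqP; rewrite eq_le measure_ge0 andbT.
  have := finite_union_bound (Q := xpredT) (c := 0) mN measurable0 (measure0 P)
    (fun (i : 'I_m) _ => mout i).
  rewrite mulr0; apply=> [i _|w [i _ Zi] _]; last by exists i.
  by rewrite (uniform_out t0 x0 unif).
have mF h : Q h -> measurable (F h).
  move=> _; apply: measurable_forall => i.
  by apply: measurable_RV; exact: measurable_cell.
have PF h : Q h -> (P (F h) <= (q ^+ k)%:E)%E.
  move=> /andP[/tuple_uniqP s_inj _].
  rewrite [P _](independent_event
    (C := fun i : 'I_k => cell dt dx (time_index h.2 i) (space_index h.2 i))
    (f := fun i => tnth h.1 i) indep); last 2 first.
  - by move=> i j /val_inj/s_inj.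
  - by move=> i; exact: measurable_cell.
  rewrite -[k in (q ^+ k)]card_ord -prodr_const -prodEFin.
  apply: lee_prod_ge0 => i; first exact: measure_ge0.
  apply: (uniform_le t0 x0 unif); first exact: measurable_cell.
  by rewrite cell_mass.
apply: (le_trans (finite_union_bound (measurable_lpp_ge k m) mN PN mF PF _)).
  move=> w /= /(lpp_geP _ _ _ _ _ _ (ltW B0))[s ch] nN.
  have pE (i : 'I_k) : nth 0%N [seq val j | j <- s] i = tnth s i.
    by rewrite (nth_map (tnth s i)) ?size_tuple // -tnth_nth.
  have inbox i : (i < k)%N -> box t x (Z (nth 0%N [seq val j | j <- s] i) w).
    move=> ik; apply: contrapT => out; apply: nN.
    by exists (tnth s (Ordinal ik)) => //; rewrite /= -(pE (Ordinal ik)).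
  have [g adm cg] := chain_cells a0 b0 B0 t0 k_gt0 ch inbox.
  exists (s, g); last by move=> i /=; rewrite -pE; exact: cg.
  (* Distinct points come from distinct indices, as independence requires. *)
  rewrite /Q adm andbT /=; have := chain_uniq ch.
  rewrite /mkseq (map_comp (Z ^~ w)) => /map_uniq; rewrite -/(mkseq _ _).
  rewrite -[X in mkseq _ X](size_tuple s) -(size_map val) mkseq_nth.
  exact: map_uniq.
rewrite lee_fin.
have cQ : (#|Q| <= m ^ k * #|@admissible _ a b k|)%N.
  rewrite -[m in (m ^ k)%N]card_ord -card_tuple -cardX; apply: subset_leq_card.
  by apply/fintype.subsetP => h /andP[_ ?]; rewrite inE.
apply: (@le_trans _ _ ((m%:R * (80 * 2 `^ ((1 + b) / a)) * q) ^+ k)).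
  rewrite [leRHS]exprMn ler_wpM2r ?exprn_ge0 //.
  apply: (@le_trans _ _ (m ^ k * #|@admissible _ a b k|)%:R); first by rewrite ler_nat.
  rewrite natrM natrX exprMn ler_wpM2l ?exprn_ge0 //.
  exact: card_admissible.
rewrite le_eqVlt; apply/orP; left; apply/eqP; congr (_ ^+ k).
rewrite /q; have -> : dx = (B * t `^ b) `^ (1 / a) / k%:R `^ ((b + 1) / a).
  rewrite /dx powR_divr ?(ltW t0) //.
  rewrite (_ : B / k%:R * _ = B * t `^ b / k%:R `^ (b + 1)).
    by rewrite powR_divr ?mulr_ge0 ?powR_ge0 ?powR_gt0 ?(ltW B0) // -powRrM mulrA mulr1.
  rewrite powRD ?powRr1 ?(ltW k0) //; last first.
    by rewrite [k%:R == 0]gt_eqF // implybT.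
  by field; rewrite !gt_eqF ?powR_gt0.
rewrite powR_divr ?mulr_ge0 ?powR_ge0 ?powR_gt0 ?(ltW B0) // powR_root ?(ltW x0) //.
have -> : (a + b + 1) / a = 1 + (b + 1) / a by field; rewrite gt_eqF.
rewrite [k%:R `^ (1 + _)]powRD ?powRr1 ?(ltW k0) //; last first.
  by rewrite [k%:R == 0]gt_eqF // implybT.
rewrite /dt; field; rewrite !gt_eqF ?powR_gt0 //.
Qed.
End UpperTail.

(** * Geometry of the slots for the lower tail *)

Lemma chain_of_gaps (R : realType) (a b B s h : R) n (p : nat -> plane R) :
  0 < a -> 0 <= b -> 0 < s ->
  (forall i, (i < n)%N -> s <= (p i).1 - (pred_point p i).1) ->
  (forall i, (i < n)%N -> `|(p i).2| <= h) ->
  n%:R * ((2 * h) `^ a / s `^ b) <= B -> chain a b B n p.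
Proof.
move=> a0 b0 s0 gap width nB; split=> [i ik|].
  by rewrite -subr_gt0 (lt_le_trans s0) // gap.
apply: le_trans nB; rewrite mulr_natl -[n in _ *+ n]card_ord -sumr_const.
apply: ler_sum => -[i ik] _ /=.
have h0 : 0 <= h by exact: le_trans (width i ik).
have si := gap i ik; have s1 := lt_le_trans s0 si.
rewrite /link_cost ler_pM ?powR_ge0 ?invr_ge0 ?powR_ge0 //.
  apply: ge0_ler_powR; rewrite ?nnegrE ?(ltW a0) ?mulr_ge0 //.
  rewrite (le_trans (ler_normB _ _)) // mulr_natl mulr2n lerD ?width //.
  (* The origin, which precedes the first point, also has height at most [h]. *)
  by case: i ik {si s1} => [|i] ik /=; rewrite ?normr0 // width // ltnW.
rewrite lef_pV2 ?posrE ?powR_gt0 ?normr_gt0 ?gt_eqF // gtr0_norm //.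
by apply: ge0_ler_powR; rewrite ?nnegrE ?(ltW s0) ?(ltW s1).
Qed.

Section LowerTail.
Context {R : realType}.
Variables (a b t x B : R) (k : nat).
Hypotheses (a0 : 0 < a) (b0 : 0 <= b) (t0 : 0 < t) (x0 : 0 < x) (B0 : 0 < B).
Hypothesis k_gt0 : (0 < k)%N.

(** The time interval splits into $4k$ pieces, alternately gaps and the $2k$ slots. *)
Definition slot_length : R := t / (4 * k%:R).

(** Solves $2k(2h)^a/s^b=B$ for [h], so that $2k$ links fit the budget, cut at [x] to stay in the
    box. *)
Definition slot_height : R :=
  Num.min x (2^-1 * (B * slot_length `^ b / (2 * k%:R)) `^ (1 / a)).

Local Notation s := slot_length.
Local Notation h := slot_height.

(* Time gaps of length [slot_length] separate consecutive slots, so that links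
   between them have bounded cost. *)
Definition slot (j : nat) : set (plane R) :=
  `](2 * j + 1)%:R * s, (2 * j + 2)%:R * s[ `*` `[- h, h].

Let k0 : 0 < k%:R :> R. Proof. by rewrite ltr0n. Qed.

Let s0 : 0 < s. Proof. by rewrite divr_gt0 // mulr_gt0. Qed.

Let h0 : 0 < h.
Proof.
rewrite lt_min x0 mulr_gt0 ?invr_gt0 // powR_gt0 // divr_gt0 ?mulr_gt0 //.
by rewrite powR_gt0.
Qed.

Lemma measurable_slot j : measurable (slot j).
Proof. by apply: measurableX; exact: measurable_itv. Qed.

Lemma slot_mass j : plane_measure (slot j) = (2 * h * s)%:E.
Proof.
rewrite plane_measureX; [|exact: measurable_itv..].
rewrite !lebesgue_measure_itv /= !lte_fin gtrN // ltr_pM2r // ltr_nat ltn_add2l /=.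
by rewrite -!EFinB -EFinM -mulrBl !natrD; congr EFin; ring.
Qed.

Lemma slot_sub_box j : (j < 2 * k)%N -> slot j `<=` box t x.
Proof.
move=> jk [u v] [/=]; rewrite !in_itv /= => /andP[u1 u2] /andP[v1 v2].
have hx : h <= x by rewrite ge_min lexx.
split; rewrite /= in_itv /=; apply/andP; split; last 2 first.
- by apply: le_trans v1; rewrite lerN2.
- exact: le_trans hx.
- by apply: le_trans (ltW u1); rewrite mulr_ge0 // ltW.
apply: le_trans (ltW u2) _; rewrite /s mulrA ler_pdivrMr ?mulr_gt0 //.
by rewrite mulrC ler_pM2l // -natrM ler_nat; move: jk; clear; lia.
Qed.

Lemma slot_disjoint i j (q : plane R) : slot i q -> slot j q -> i = j.
Proof.
wlog: i j / (i <= j)%N => [W iq jq|].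
  by have [/W|/ltnW/W] := leqP i j; [apply|move=> /(_ jq iq)].
rewrite leq_eqVlt => /predU1P[//|ij] [/= + _] [/= + _].
rewrite !in_itv /= => /andP[_ q1] /andP[q2 _].
have := lt_trans q2 q1; rewrite ltr_pM2r // ltr_nat; move: ij; clear; lia.
Qed.

Lemma slot_gap i j (q r : plane R) : (i < j)%N -> slot i q -> slot j r ->
  s <= r.1 - q.1.
Proof.
move=> ij [/= + _] [/= + _]; rewrite !in_itv /= => /andP[_ q1] /andP[q2 _].
have : (2 * i + 3)%:R * s <= (2 * j + 1)%:R * s.
  by rewrite ler_pM2r // ler_nat; move: ij; clear; lia.
rewrite -[3%N]/(2 + 1)%N addnA natrD mulrDl mul1r => h.
by rewrite lerBrDl (le_trans (lerD (ltW q1) (lexx s))) // (le_trans h) // ltW.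
Qed.

Lemma slots_lpp (Omega : Type) (Z : nat -> Omega -> plane R) m w
    (T : {set 'I_(2 * k)}) :
  (forall j, j \in T -> exists i : 'I_m, slot j (Z i w)) ->
  (#|T| <= entropy_lpp Z a b B m w)%N.
Proof.
(* A nonempty [T] provides the sample index [i0], used as default outside [T]. *)
move=> TP; have [->|/set0Pn[j0 j0T]] := eqVneq T finset.set0; first by rewrite cards0.
have [i0 _] := TP _ j0T.
have idx j : exists i : 'I_m, j \in T -> slot j (Z i w).
  by case: (boolP (j \in T)) => [/TP[i H]|_]; [exists i|exists i0].
have [f fP] := choice idx.
pose l := enum T; have sl : size l = #|T| by rewrite -cardE.
have lT i : (i < #|T|)%N -> nth j0 l i \in T.
  by move=> iT; rewrite -mem_enum mem_nth // sl.
have l_lt i : (i.+1 < #|T|)%N -> (nth j0 l i < nth j0 l i.+1)%N.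
  move=> iT; have : sorted ltn [seq val j | j <- l].
    have -> : l = [seq j <- enum 'I_(2 * k) | j \in T] by rewrite enumT.
    rewrite sorted_map; apply: sorted_filter; first by move=> ? ? ?; exact: ltn_trans.
    by rewrite -sorted_map val_enum_ord iota_ltn_sorted.
  move=> /(sortedP 0%N)/(_ i); rewrite size_map sl => /(_ iT).
  by rewrite !(nth_map j0) ?sl // ltnW.
apply/(lpp_geP _ _ _ _ _ _ (ltW B0)).
exists [tuple f (nth j0 l i) | i < #|T|].
set p := fun i => Z _ w.
have pE i : (i < #|T|)%N -> p i = Z (f (nth j0 l i)) w.
  move=> iT; rewrite /p (nth_map i0) ?size_tuple //.
  by rewrite -[i]/(val (Ordinal iT)) -tnth_nth tnth_mktuple.
have pS i : (i < #|T|)%N -> slot (nth j0 l i) (p i).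
  by move=> iT; rewrite pE //; apply: fP; exact: lT.
apply: (@chain_of_gaps _ _ _ _ s h) => //.
- case=> [|i] iT /=; last by apply: slot_gap (l_lt _ iT) (pS _ _) (pS _ _); rewrite // ltnW.
  (* Every slot starts no earlier than [s], which separates the first point from the origin. *)
  have [/= + _] := pS 0%N iT; rewrite in_itv subr0 => /andP[+ _].
  by move/ltW; apply: le_trans; rewrite ler_peMl ?(ltW s0) // ler1n addn1.
- by move=> i iT; have [_ /=] := pS i iT; rewrite in_itv ler_norml.
apply: (@le_trans _ _ ((2 * k)%:R * ((2 * h) `^ a / s `^ b))).
  rewrite ler_wpM2r ?divr_ge0 ?powR_ge0 // ler_nat.
  by rewrite (leq_trans (max_card _)) // card_ord.
rewrite natrM mulrA ler_pdivrMr ?powR_gt0 // mulrC -ler_pdivlMr ?mulr_gt0 //.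
have e0 : 0 <= B * s `^ b / (2 * k%:R).
  by rewrite divr_ge0 ?mulr_ge0 ?powR_ge0 // ltW.
rewrite -[leRHS](@powR_root _ _ a^-1) ?invr_gt0 // div1r invrK.
apply: ge0_ler_powR; rewrite ?nnegrE ?powR_ge0 ?mulr_ge0 ?(ltW h0) ?(ltW a0) //.
rewrite mulrC -ler_pdivlMr // [leRHS]mulrC -[a^-1]div1r.
by rewrite /slot_height ge_min lexx orbT.
Qed.

(** The second term of the minimum in [slot_height] is exactly [c * D * x]; the first is handled by
    [c <= 1]. *)
Lemma slot_height_ge :
  2^-1 * 2 `^ (- (1 / a)) * 4 `^ (- (b / a)) *
    Num.min ((B * t `^ b / x `^ a) `^ (1 / a) / k%:R `^ ((b + 1) / a)) 1 <= h / x.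
Proof.
set c := _ * 4 `^ _; set D := _ / k%:R `^ _.
have c0 : 0 < c by rewrite !mulr_gt0 ?powR_gt0 ?invr_gt0.
have neg1 (y u : R) : 1 <= y -> 0 <= u -> y `^ (- u) <= 1.
  move=> y1 u0; rewrite powRN invf_le1 ?powR_ge1 // powR_gt0 //.
  exact: lt_le_trans y1.
have ia0 : 0 <= 1 / a by rewrite divr_ge0 // ltW.
have ba0 : 0 <= b / a by rewrite divr_ge0 // ltW.
have c1 : c <= 1.
  rewrite mulr_ile1 ?mulr_ge0 ?powR_ge0 ?invr_ge0 ?neg1 ?ler1n //.
  by rewrite mulr_ile1 ?powR_ge0 ?invr_ge0 ?neg1 ?ler1n // invf_le1 // ler1n.
have hE : 2^-1 * (B * s `^ b / (2 * k%:R)) `^ (1 / a) = c * D * x.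
  have Bt0 : 0 <= B * t `^ b by rewrite mulr_ge0 ?powR_ge0 // ltW.
  have -> : D = (B * t `^ b) `^ (1 / a) / x / k%:R `^ ((b + 1) / a).
    by rewrite /D powR_divr ?powR_gt0 // powR_root // ltW.
  have -> : s `^ b = t `^ b / (4 `^ b * k%:R `^ b).
    by rewrite /s powR_divr ?(ltW t0) ?mulr_gt0 // powRM.
  rewrite (_ : _ / (2 * k%:R) = B * t `^ b / (2 * (4 `^ b * k%:R `^ (b + 1)))).
    rewrite powR_divr ?mulr_gt0 ?powR_gt0 // !powRM ?mulr_ge0 ?powR_ge0 ?(ltW B0) //.
    rewrite -!powRrM !mulrA !mulr1 /c !powRN.
    by field; rewrite !gt_eqF ?powR_gt0.
  rewrite powRD ?powRr1 ?(ltW k0) //; last first.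
    by rewrite [k%:R == 0]gt_eqF // implybT.
  by field; rewrite !gt_eqF ?powR_gt0.
rewrite ler_pdivlMr // /slot_height hE le_min.
have m1 : Num.min D 1 <= 1 by rewrite ge_min lexx orbT.
have mD : Num.min D 1 <= D by rewrite ge_min lexx.
have m0 : 0 <= Num.min D 1 by rewrite le_min ler01 andbT divr_ge0 ?powR_ge0.
apply/andP; split; last by rewrite ler_pM2r // ler_pM2l.
rewrite -[leRHS]mul1r ler_pM2r // mulr_ile1 // ltW //.
Qed.

End LowerTail.

(** * Lower tail by a union over sets of empty slots *)

Section LowerTailProbability.
Context d (Omega : measurableType d) (R : realType) (P : probability Omega R).
Context (Z : nat -> {RV P >-> plane R}).
Variables (a b t x B : R).
Hypotheses (a0 : 0 < a) (b0 : 0 <= b) (t0 : 0 < t) (x0 : 0 < x) (B0 : 0 < B).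
Hypothesis indep : mutually_independent Z.
Hypothesis unif : forall i, uniform_on plane_measure (box t x) (Z i).

(** At least [k] disjoint slots fill a fraction at least $h/(4x)$ of the box, and $1-u\le
    e^{-u}$. *)
Lemma slots_empty k (S : {set 'I_(2 * k)}) i : (0 < k)%N -> (k <= #|S|)%N ->
  (P (Z i @^-1` (~` \big[setU/set0]_(j in S) slot a b t x B k j)) <=
    (expR (- (slot_height a b t x B k / (4 * x))))%:E)%E.
Proof.
move=> k_gt0 kS; have k0 : 0 < k%:R :> R by rewrite ltr0n.
set U := \big[setU/set0]_(j in S) _.
have ms j : measurable (slot a b t x B k j) by exact: measurable_slot.
have mU : measurable U by exact: bigsetU_measurable.
have massU : plane_measure U =
    (#|S|%:R * (2 * slot_height a b t x B k * slot_length t k))%:E.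
  rewrite /U measure_bigsetU_ord_cond //; last first.
    move=> i1 i2 _ _ [q [q1 q2]]; apply: val_inj.
    by apply: slot_disjoint q1 q2.
  transitivity (\sum_(j in S)
      (2 * slot_height a b t x B k * slot_length t k)%:E)%E.
    by apply: eq_bigr => j _; exact: slot_mass.
  by rewrite sumEFin sumr_const -[X in X%:E = _]mulr_natl.
have subU : U `<=` box t x.
  rewrite /U; elim/big_ind: _ => // [A1 A2 H1 H2|j _]; first by rewrite subUset.
  exact: slot_sub_box.
have -> : Z i @^-1` (~` U) = ~` (Z i @^-1` U) by [].
rewrite probability_setC; last exact: (measurable_RV Z i mU).
rewrite (uniform_sub t0 x0 unif _ mU subU massU) -EFinB lee_fin.
set h := slot_height _ _ _ _ _ _.
have h0 : 0 < h.
  rewrite /h lt_min x0 mulr_gt0 ?invr_gt0 // powR_gt0 // divr_gt0 ?mulr_gt0 //.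
  by rewrite powR_gt0 // divr_gt0 // mulr_gt0.
apply: le_trans (expR_ge1Dx _); rewrite lerD2l lerN2 /slot_length.
rewrite [leRHS](_ : _ = #|S|%:R / k%:R * (h / (4 * x))); last first.
  by field; rewrite !gt_eqF.
rewrite ler_peMl ?divr_ge0 ?mulr_ge0 ?(ltW h0) ?(ltW x0) //.
by rewrite ler_pdivlMr // mul1r ler_nat.
Qed.

Lemma lpp_lower_tail k m : (0 < k)%N ->
  (P [set w | (entropy_lpp Z a b B m w <= k)%N] <=
    (4 ^+ k * expR (- (slot_height a b t x B k / (4 * x))) ^+ m)%:E)%E.
Proof.
move=> k_gt0; set e := expR _.
pose Q (S : {set 'I_(2 * k)}) := (k <= #|S|)%N.
pose C (S : {set 'I_(2 * k)}) := ~` \big[setU/set0]_(j in S) slot a b t x B k j.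
pose F (S : {set 'I_(2 * k)}) := [set w | forall i : 'I_m, C S (Z i w)].
have mC S : measurable (C S).
  by apply/measurableC/bigsetU_measurable => j _; exact: measurable_slot.
have mF S : Q S -> measurable (F S).
  by move=> _; apply: measurable_forall => i; exact: measurable_RV.
have PF S : Q S -> (P (F S) <= (e ^+ m)%:E)%E.
  move=> QS; rewrite [P _](independent_event (f := @nat_of_ord m)
    (C := fun=> C S) indep (@ord_inj m) (fun=> mC S)).
  rewrite -[m in (e ^+ m)]card_ord -prodr_const -prodEFin.
  apply: lee_prod_ge0 => i; first exact: measure_ge0.
  exact: slots_empty.
apply: (le_trans (finite_union_bound (measurable_lpp_le Z a b B0 k m)
  measurable0 (measure0 P) mF PF _)).
  move=> w /= Lk _.
  pose T := [set j : 'I_(2 * k) | `[< exists i : 'I_m, slot a b t x B k j (Z i w) >]]%SET.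
  have TL : (#|T| <= k)%N.
    apply: leq_trans Lk.
    apply: (slots_lpp a0 b0 t0 x0 B0 k_gt0 (Z := fun i => Z i)) => j.
    by rewrite inE => /asboolP.
  (* At most [k] of the $2k$ slots are occupied, so at least [k] are empty. *)
  exists (~: T)%SET.
    by rewrite /Q -(leq_add2l #|T|) cardsC card_ord [leqRHS]mul2n -addnn leq_add2r.
  move=> i; rewrite /C /= => Zi.
  have [j + sj] : exists2 j, j \in (~: T)%SET & slot a b t x B k j (Z i w).
    by move: Zi; elim/big_rec: _ => // j A jT IH [Hj|/IH//]; exists j.
  by rewrite !inE => /negP; apply; apply/asboolP; exists i.
rewrite lee_fin ler_wpM2r ?exprn_ge0 ?expR_ge0 //.
rewrite -natrX ler_nat (leq_trans (max_card _)) //.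
by rewrite -cardsT -powersetT card_powerset cardsT card_ord expnM.
Qed.

(** Uses $4\le e^2$; the $8$ in [c] joins the $1/2$ of [slot_height_ge] to the $1/4$ of the slot
    fraction. *)
Lemma lpp_lower_tail_exp k m (c := 2 `^ (- (1 / a)) * 4 `^ (- (b / a)) / 8) :
  (0 < k)%N ->
  (P [set w | (entropy_lpp Z a b B m w <= k)%N] <=
    (expR (k%:R * (2 - c *
       (Num.min ((B * t `^ b / x `^ a) `^ (1 / a) / k%:R `^ ((b + 1) / a)) 1 *
        (m%:R / k%:R)))))%:E)%E.
Proof.
move=> k_gt0; have k0 : 0 < k%:R :> R by rewrite ltr0n.
apply: le_trans (lpp_lower_tail m k_gt0) _; rewrite lee_fin.
have := slot_height_ge a0 b0 t0 x0 B0 k_gt0.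
set A := Num.min _ _; set h := slot_height _ _ _ _ _ _ => hA.
rewrite (_ : _ * (_ - _) = k%:R * 2 + m%:R * - (c * A)); last by field; rewrite gt_eqF.
rewrite expRD; apply: ler_pM; rewrite ?exprn_ge0 ?expR_ge0 //.
  rewrite expRM_natl lerXn2r ?nnegrE ?expR_ge0 //.
  rewrite (_ : 2 = 2%:R * 1) ?mulr1 // -[2%:R]mulr1 expRM_natl.
  have := @expR_ge1Dx R 1; nra.
rewrite expRM_natl lerXn2r ?nnegrE ?expR_ge0 // ler_expR lerN2.
rewrite invfM mulrCA [leRHS]mulrC -/h; move: hA; rewrite /c; lra.
Qed.

End LowerTailProbability.

(** * Summability of stretched exponentials and Borel-Cantelli *)

Lemma powR_unbounded (R : realType) (e M : R) : 0 < e ->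
  exists m0 : nat, forall m, (m0 <= m)%N -> M <= m%:R `^ e.
Proof.
move=> e0; exists (Num.truncn (Num.max M 0 `^ (1 / e))).+1 => m mM.
have M0 : 0 <= Num.max M 0 by rewrite le_max lexx orbT.
apply: (@le_trans _ _ (Num.max M 0)); first by rewrite le_max lexx.
rewrite -[leLHS](@powR_root _ _ e) // powRAC.
apply: ge0_ler_powR; rewrite ?nnegrE ?powR_ge0 ?(ltW e0) //.
by rewrite ltW // (lt_le_trans (truncnS_gt _)) // ler_nat.
Qed.

Lemma expR_ge_pow (R : realType) (y : R) n : 0 <= y -> (0 < n)%N ->
  (y / n%:R) ^+ n <= expR y.
Proof.
move=> y0 n0; have -> : expR y = expR (n%:R * (y / n%:R)).
  by congr expR; rewrite mulrC divfK ?gt_eqF ?ltr0n.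
rewrite expRM_natl lerXn2r ?nnegrE ?expR_ge0 ?divr_ge0 //.
by rewrite (le_trans _ (expR_ge1Dx _)) // lerDr.
Qed.

(** Comparison with $1/((m+1)(m+2))$, written as a difference so that its sums telescope. *)
Lemma stretched_exp_le (R : realType) (kappa e : R) : 0 < kappa -> 0 < e ->
  exists m0 : nat, forall m, (m0 <= m)%N ->
    expR (- (kappa * m%:R `^ e)) <= m.+1%:R^-1 - m.+2%:R^-1.
Proof.
move=> k0 e0.
(* With $ne\ge 3$, the bound $e^y\ge (y/n)^n$ dominates $c\,m^3$. *)
pose n := (Num.truncn (3 / e)).+1; have n0 : 0 < n%:R :> R by rewrite ltr0n.
have ne : 3 <= n%:R * e by rewrite -ler_pdivrMr // ltW // truncnS_gt.
pose c := (kappa / n%:R) ^+ n; have c0 : 0 < c by rewrite exprn_gt0 // divr_gt0.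
(* Beyond this threshold $c\,m^3\ge 6m^2\ge (m+1)(m+2)$. *)
exists (Num.truncn (6 / c)).+1 => m mM.
have m1 : 1 <= m%:R :> R by rewrite ler1n (leq_trans _ mM).
have mc : 6 <= c * m%:R.
  rewrite mulrC -ler_pdivrMr // ltW // (lt_le_trans (truncnS_gt _)) //.
  by rewrite ler_nat.
have low : c * m%:R ^+ 3 <= expR (kappa * m%:R `^ e).
  have := @expR_ge_pow R (kappa * m%:R `^ e) n; rewrite mulr_ge0 ?powR_ge0 ?(ltW k0) //.
  move=> /(_ isT isT); apply: le_trans.
  rewrite mulrAC exprMn ler_pM2l // -[leRHS]powR_mulrn ?powR_ge0 // -powRrM.
  by rewrite -[leLHS]powR_mulrn // ler_powR // mulrC.
rewrite -[m.+2]addn2 -[m.+1]addn1 !natrD.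
have -> : (m%:R + 1)^-1 - (m%:R + 2)^-1 = ((m%:R + 1) * (m%:R + 2))^-1 :> R.
  by field; rewrite !gt_eqF //; lra.
rewrite expRN lef_pV2 ?posrE ?expR_gt0 ?mulr_gt0 ?addr_gt0 //; try lra.
apply: le_trans low; nra.
Qed.

Section BorelCantelli.
Context d (Omega : measurableType d) (R : realType) (P : probability Omega R).

Lemma borel_cantelli_stretched (kappa e : R) (F : nat -> set Omega) (m0 : nat) :
  0 < kappa -> 0 < e -> (forall m, measurable (F m)) ->
  (forall m, (m0 <= m)%N -> (P (F m) <= (expR (- (kappa * m%:R `^ e)))%:E)%E) ->
  {ae P, forall w, exists n : nat, forall m, (n <= m)%N -> ~ F m w}.
Proof.
move=> k0 e0 mF PF; have [m1 m1P] := stretched_exp_le k0 e0.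
pose n0 := maxn m0 m1.
(* Emptying the early events makes the summable bound valid at every index. *)
pose G m := if (n0 <= m)%N then F m else set0.
have mG m : measurable (G m) by rewrite /G; case: ifP.
have PG m : (P (G m) <= (m.+1%:R^-1 - m.+2%:R^-1)%:E)%E.
  rewrite /G; case: ifPn => [|_]; last first.
    by rewrite measure0 lee_fin subr_ge0 lef_pV2 ?posrE // ler_nat.
  rewrite geq_max => /andP[/PF h1 /m1P h2].
  by apply: le_trans h1 _; rewrite lee_fin.
have P0 : P (lim_sup_set G) = 0%E.
  apply: lim_sup_set_cvg0 => //; apply: (@le_lt_trans _ _ 1%E); last exact: ltry.
  apply: lime_le; first by apply: is_cvg_nneseries => *; exact: measure_ge0.
  apply: nearW => n; apply: (@le_trans _ _
    (\sum_(0 <= i < n) (i.+1%:R^-1 - i.+2%:R^-1)%:E)%E).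
    by apply: lee_sum => i _; exact: PG.
  rewrite sumEFin lee_fin.
  rewrite (eq_bigr (fun i => (- i.+2%:R^-1) - (- i.+1%:R^-1 : R))); last first.
    by move=> i _; rewrite opprK addrC.
  by rewrite telescope_sumr // opprK invr1 gerDr oppr_le0 invr_ge0.
exists (lim_sup_set G); split => //.
  by apply: bigcap_measurableType => n _; apply: bigcup_measurable => j _; exact: mG.
move=> w nw n _; apply: contrapT => H; apply: nw; exists (maxn n n0) => m.
rewrite geq_max => /andP[nm n0m] Fm; apply: H; exists m => //=.
by rewrite /G n0m.
Qed.

End BorelCantelli.

(** * Almost sure order of growth *)

Section AlmostSure.
Context d (Omega : measurableType d) (R : realType) (P : probability Omega R).
Context (Z : nat -> {RV P >-> plane R}).
Variables (a b t x B : R).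
Hypotheses (a0 : 0 < a) (b0 : 0 <= b) (t0 : 0 < t) (x0 : 0 < x) (B0 : 0 < B).
Hypothesis indep : mutually_independent Z.
Hypothesis unif : forall i, uniform_on plane_measure (box t x) (Z i).

Let ratio := B * t `^ b / x `^ a.
Let theta := ratio `^ (1 / (a + b + 1)).
Let gamma := (a + b + 1) / a.
Let scale (m : nat) := theta * m%:R `^ (a / (a + b + 1)).

Let ratio0 : 0 < ratio.
Proof. by rewrite divr_gt0 ?mulr_gt0 ?powR_gt0. Qed.

Let abp : 0 < a + b + 1. Proof. by rewrite addr_gt0 // ltr_wpDr. Qed.

Let theta0 : 0 < theta. Proof. by rewrite powR_gt0. Qed.

Let gamma1 : 1 <= gamma.
Proof. by rewrite ler_pdivlMr // mul1r -addrA lerDl addr_ge0. Qed.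

Let gamma_ge0 : 0 <= gamma. Proof. exact: le_trans gamma1. Qed.

Let scale_ge0 m : 0 <= scale m.
Proof. by rewrite mulr_ge0 ?powR_ge0 ?(ltW theta0). Qed.

(** Both tail bounds depend on the ratio of [scale m] to [k] through this power, whose exponent
    [gamma] equals $1+(1+b)/a$. *)
Let scale_powR m k : (0 < k)%N ->
  (scale m / k%:R) `^ gamma = ratio `^ (1 / a) * m%:R / k%:R `^ gamma.
Proof.
move=> k0; rewrite powR_divr ?ltr0n // powRM ?powR_ge0 // -!powRrM.
congr (_ `^ _ * _ / _); first by rewrite /gamma; field; rewrite !gt_eqF.
rewrite (_ : _ * gamma = 1) ?powRr1 //.
by rewrite /gamma; field; rewrite !gt_eqF.
Qed.

(** For $k\ge 192\,\mathrm{scale}$ the base of the upper tail is at most $40\cdot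
    2^{(1+b)/a}/192^{\gamma}\le 40/192$, because $192^\gamma=96^\gamma\cdot 2\cdot 2^{(1+b)/a}$.
    Thus the tail is below $2^{-k}\le e^{-k/2}$. *)
Lemma lpp_eventually_le : {ae P, forall w, exists n : nat, forall m, (n <= m)%N ->
  (entropy_lpp Z a b B m w)%:R <= 192 * scale m}.
Proof.
pose k m := (Num.truncn (192 * scale m)).+1.
have H := @borel_cantelli_stretched _ _ _ P (96 * theta) (a / (a + b + 1))
  (fun m => [set w | (k m <= entropy_lpp Z a b B m w)%N]) 0%N.
apply: filterS (H _ _ _ _) => [w [n nP]|||m|m _].
- exists n => m /nP /negP; rewrite -ltnNge ltnS truncn_ge_nat //.
  by rewrite mulr_ge0.
- by rewrite mulr_gt0.
- by rewrite divr_gt0.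
- exact: measurable_lpp_ge.
apply: le_trans (lpp_upper_tail a0 b0 t0 x0 B0 indep unif m (ltn0Sn _)) _.
rewrite -/(k m) lee_fin.
have k0 : 0 < (k m)%:R :> R by rewrite ltr0n.
have sk : 192 * scale m <= (k m)%:R by rewrite ltW // truncnS_gt.
apply: (@le_trans _ _ (2^-1 ^+ k m)).
  rewrite -/ratio -/gamma.
  rewrite (_ : _ / _ `^ gamma =
    40 * 2 `^ ((1 + b) / a) * (scale m / (k m)%:R) `^ gamma); last first.
    by rewrite scale_powR // !mulrA.
  rewrite lerXn2r ?nnegrE ?mulr_ge0 ?powR_ge0 ?invr_ge0 //.
  have : (scale m / (k m)%:R) `^ gamma <= 192^-1 `^ gamma.
    apply: ge0_ler_powR; rewrite ?nnegrE ?gamma_ge0 ?divr_ge0 //.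
    by rewrite ler_pdivrMr // mulrC ler_pdivlMr // mulrC.
  have -> : 192^-1 `^ gamma = (192 `^ gamma)^-1 :> R.
    by rewrite -powR_inv1 // powRAC powR_inv1 ?powR_ge0.
  have : 192 <= 192 `^ gamma / 2 `^ ((1 + b) / a) :> R.
    rewrite (_ : 192 = 96 * 2) ?natrM; last by lra.
    rewrite powRM // (_ : 2 `^ gamma = 2 * 2 `^ ((1 + b) / a)); last first.
      rewrite -{2}(@powRr1 _ 2) // -powRD ?pnatr_eq0 ?implybT //; congr powR.
      by rewrite /gamma; field; rewrite gt_eqF.
    rewrite mulrA mulfK ?gt_eqF ?powR_gt0 // ler_pM2r //.
    by rewrite le1r_powR // ler1n.
  rewrite ler_pdivlMr ?powR_gt0 //.
  set u := 2 `^ _; set v := 192 `^ _; set y := _ `^ gamma => h1 h2.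
  have u0 : 0 < u by rewrite powR_gt0.
  have v0 : 0 < v by rewrite powR_gt0.
  apply: (@le_trans _ _ (40 * u * v^-1)); first by rewrite ler_pM2l ?mulr_gt0.
  by rewrite ler_pdivrMr //; lra.
apply: (@le_trans _ _ (expR (- 2^-1) ^+ k m)).
  rewrite lerXn2r ?nnegrE ?expR_ge0 ?invr_ge0 //.
  by have := @expR_ge1Dx R (- 2^-1); lra.
rewrite -expRM_natl ler_expR.
by have : 192 * (theta * m%:R `^ (a / (a + b + 1))) <= (k m)%:R := sk; lra.
Qed.

Lemma lpp_eventually_ge : {ae P, forall w, exists n : nat, forall m, (n <= m)%N ->
  scale m / 192 <= (entropy_lpp Z a b B m w)%:R}.
Proof.
pose k m := (Num.truncn (scale m / 192)).+1.
pose c : R := 2 `^ (- (1 / a)) * 4 `^ (- (b / a)) / 8.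
have c0 : 0 < c by rewrite !mulr_gt0 ?powR_gt0.
have e1 : 0 < a / (a + b + 1) by rewrite divr_gt0.
have e2 : 0 < 1 - a / (a + b + 1).
  by rewrite subr_gt0 ltr_pdivrMr // mul1r -addrA ltrDl ltr_wpDl.
(* [m1] makes [scale m] at least $192$, whence [k m <= scale m / 96]; [m2] makes $m/k$ at least
   $3/c$. *)
have [m1 m1P] := powR_unbounded (192 / theta) e1.
have [m2 m2P] := powR_unbounded (3 / c * theta / 96) e2.
have H := @borel_cantelli_stretched _ _ _ P (theta / 192) (a / (a + b + 1))
  (fun m => [set w | (entropy_lpp Z a b B m w <= k m)%N]) (maxn 1 (maxn m1 m2)).
apply: filterS (H _ _ _ _) => [w [n nP]|||m|m].
- exists n => m /nP /negP; rewrite -ltnNge => km.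
  by rewrite ltW // (lt_trans (truncnS_gt _)) // ltr_nat.
- by rewrite divr_gt0.
- by [].
- exact: measurable_lpp_le.
rewrite !geq_max => /and3P[m_gt0 /m1P h1 /m2P h2].
apply: le_trans (lpp_lower_tail_exp a0 b0 t0 x0 B0 indep unif m (ltn0Sn _)) _.
rewrite -/(k m) lee_fin ler_expR -/c.
have k0 : 0 < (k m)%:R :> R by rewrite ltr0n.
have m0 : 0 < m%:R :> R by rewrite ltr0n.
have sk : scale m / 192 <= (k m)%:R by rewrite ltW // truncnS_gt.
have s192 : 192 <= scale m by move: h1; rewrite ler_pdivrMr // mulrC.
have ks : (k m)%:R <= scale m / 96.
  have : (Num.truncn (scale m / 192))%:R <= scale m / 192.
    by rewrite truncn_le divr_ge0.
  rewrite /k -[(Num.truncn _).+1%:R]natr1; lra.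
(* Then the exponent is at most $-k$, hence at most $-\mathrm{scale}/192$. *)
suff cA : 3 <= c * (Num.min (ratio `^ (1 / a) / (k m)%:R `^ ((b + 1) / a)) 1 *
    (m%:R / (k m)%:R)).
  move: cA; rewrite -/ratio; set A := c * _ => cA.
  have : theta * m%:R `^ (a / (a + b + 1)) / 192 <= (k m)%:R := sk.
  nra.
rewrite -ler_pdivrMl // mulrC minr_pMl ?divr_ge0 // le_min.
apply/andP; split.
  rewrite (_ : _ * (m%:R / _) = (scale m / (k m)%:R) `^ gamma); last first.
    rewrite scale_powR // (_ : gamma = (b + 1) / a + 1); last first.
      by rewrite /gamma; field; rewrite gt_eqF.
    rewrite powRD ?powRr1 ?(ltW k0) //; last first.
      by rewrite [(k m)%:R == 0]gt_eqF // implybT.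
    by field; rewrite !gt_eqF ?powR_gt0.
  (* Here $3/c=24\cdot 2^{1/a}4^{b/a}$, while $96^\gamma=24^\gamma\cdot 4\cdot 4^{1/a}4^{b/a}$ is
     larger. *)
  apply: (@le_trans _ _ (96 `^ gamma)); last first.
    apply: ge0_ler_powR; rewrite ?nnegrE ?gamma_ge0 ?divr_ge0 //.
    by rewrite ler_pdivlMr // mulrC -ler_pdivlMr.
  rewrite /c !powRN.
  have -> : 96 `^ gamma = 24 `^ gamma * (4 * 4 `^ ((1 + b) / a)) :> R.
    rewrite (_ : 96 = 24 * 4) ?natrM; last by lra.
    rewrite powRM //; congr (_ * _).
    rewrite -{2}(@powRr1 _ 4) // -powRD ?pnatr_eq0 ?implybT //; congr powR.
    by rewrite /gamma; field; rewrite gt_eqF.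
  have -> : 4 `^ ((1 + b) / a) = 4 `^ (1 / a) * 4 `^ (b / a) :> R.
    by rewrite -powRD ?pnatr_eq0 ?implybT // -mulrDl.
  have h24 : 24 <= 24 `^ gamma :> R by rewrite le1r_powR // ler1n.
  have h2a : 2 `^ (1 / a) <= 4 `^ (1 / a) :> R.
    by apply: ge0_ler_powR; rewrite ?nnegrE ?divr_ge0 ?(ltW a0) // ler_nat.
  set p4 := 4 `^ (b / a); set q := 24 `^ _ in h24 *; set u := 2 `^ _ in h2a *.
  set v := 4 `^ _ in h2a *.
  have p40 : 0 < p4 by rewrite powR_gt0.
  have u0 : 0 < u by rewrite powR_gt0.
  rewrite (_ : _ / _ = 24 * (u * p4)); last by field; rewrite !gt_eqF.
  apply: ler_pM; rewrite ?mulr_ge0 ?(ltW u0) ?(ltW p40) //.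
  rewrite mulrA ler_pM2r //; lra.
rewrite mul1r ler_pdivlMr //.
have hm : m%:R = m%:R `^ (1 - a / (a + b + 1)) * m%:R `^ (a / (a + b + 1)) :> R.
  rewrite -powRD ?subrK ?powRr1 ?(ltW m0) //.
  by rewrite [m%:R == 0]gt_eqF // implybT.
apply: (@le_trans _ _ (3 / c * (scale m / 96))).
  by rewrite ler_pM2l // divr_gt0.
rewrite [leRHS]hm /scale.
rewrite (_ : 3 / c * _ = 3 / c * theta / 96 * m%:R `^ (a / (a + b + 1))); last first.
  by field; rewrite gt_eqF.
by rewrite ler_wpM2r ?powR_ge0.
Qed.

End AlmostSure.

(** * A single constant for the lower tail, and the final assembly *)

Lemma expR_half_bound (R : realType) (c k A p : R) :
  0 < c -> c <= 1 -> 0 <= k -> p <= 1 -> p <= expR (k * (2 - c * A)) ->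
  p <= expR (c / 2 * k * (1 - c / 2 * A)).
Proof.
(* If $cA\le 2$ the target is at least $1$. Otherwise the exponents, divided by [k], differ by
   $(1-c/4)(cA-2)\ge 0$. *)
move=> c0 c1 k0 p1 pA; have [cA|cA] := leP (c * A) 2.
  apply: le_trans p1 _; rewrite -[leLHS]expR0 ler_expR; apply: mulr_ge0; last by lra.
  by apply: mulr_ge0 => //; lra.
apply: le_trans pA _; rewrite ler_expR.
rewrite [leRHS](_ : _ = k * (c / 2 * (1 - c / 2 * A))); last by ring.
rewrite ler_wpM2l //.
suff : 0 <= (1 - c / 4) * (c * A - 2) by lra.
by apply: mulr_ge0; lra.
Qed.

Theorem theorem2p3 (R : realType) :
  (forall a b : R, 0 <= b -> b <= a -> 0 < a ->
   exists c3 c4 : R, [/\ 0 < c3, 0 < c4 &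
   forall t x B : R, 0 < t -> 0 < x -> 0 < B ->
   forall (d : measure_display) (Omega : measurableType d)
     (P : probability Omega R) (Z : nat -> {RV P >-> plane R}),
   mutually_independent Z ->
   (forall i, uniform_on plane_measure (box t x) (Z i)) ->
   forall k m : nat, (1 <= k)%N -> (k <= m)%N ->
     (P [set w | (k <= entropy_lpp Z a b B m w)%N] <=
       ((c3 * (B * t `^ b / x `^ a) `^ (1 / a) * m%:R /
          k%:R `^ ((a + b + 1) / a)) ^+ k)%:E)%E /\
     (P [set w | (entropy_lpp Z a b B m w <= k)%N] <=
       (expR (c4 * k%:R *
          (1 - c4 * Num.min ((B * t `^ b / x `^ a) `^ (1 / a) /
                              k%:R `^ ((b + 1) / a)) 1 * (m%:R / k%:R))))%:E)%E])
  /\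
  (exists2 C : R, 0 < C &
   forall t x B a b : R, 0 < t -> 0 < x -> 0 < B ->
   0 <= b -> b <= a -> 0 < a ->
   forall (d : measure_display) (Omega : measurableType d)
     (P : probability Omega R) (Z : nat -> {RV P >-> plane R}),
   mutually_independent Z ->
   (forall i, uniform_on plane_measure (box t x) (Z i)) ->
   {ae P, forall w, exists m0 : nat, forall m : nat, (m0 <= m)%N ->
     let r := (entropy_lpp Z a b B m w)%:R /
       ((B * t `^ b / x `^ a) `^ (1 / (a + b + 1)) *
        m%:R `^ (a / (a + b + 1))) in
     1 / C <= r /\ r <= C}).
Proof.
split.
  move=> a b b0 _ a0.
  have c0 : 0 < 2 `^ (- (1 / a)) * 4 `^ (- (b / a)) / 8 :> R.
    by rewrite !mulr_gt0 ?powR_gt0.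
  exists (40 * 2 `^ ((1 + b) / a)), (2 `^ (- (1 / a)) * 4 `^ (- (b / a)) / 8 / 2).
  split; [by rewrite mulr_gt0 ?powR_gt0|by rewrite divr_gt0|].
  move=> t x B t0 x0 B0 d Omega P Z indep unif k m k1 _; split.
    exact: lpp_upper_tail.
  have c1 : 2 `^ (- (1 / a)) * 4 `^ (- (b / a)) / 8 <= 1 :> R.
    have le1 (y u : R) : 1 <= y -> 0 <= u -> y `^ (- u) <= 1.
      move=> y1 u0; rewrite powRN invf_le1 ?powR_ge1 // powR_gt0 //.
      exact: lt_le_trans y1.
    rewrite mulr_ile1 ?mulr_ge0 ?powR_ge0 ?invr_ge0 ?invf_le1 ?ler1n //.
    by rewrite mulr_ile1 ?powR_ge0 ?le1 ?ler1n // divr_ge0 // ltW.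
  have := lpp_lower_tail_exp a0 b0 t0 x0 B0 indep unif m k1.
  have := probability_le1 P (measurable_lpp_le Z a b B0 k m).
  case: (P _) => [p| |] //=; rewrite ?leNye // !lee_fin => p1 pA.
  rewrite -[X in 1 - X]mulrA; exact: expR_half_bound pA.
(* The same number serves both almost sure bounds, whatever [a] and [b]. *)
exists 192 => // t x B a b t0 x0 B0 b0 _ a0 d Omega P Z indep unif.
have ub := lpp_eventually_le a0 b0 t0 x0 B0 indep unif.
have lb := lpp_eventually_ge a0 b0 t0 x0 B0 indep unif.
apply: filterS2 ub lb => w [n1 H1] [n2 H2].
(* The $1$ keeps [m] positive, so that the normalization is nonzero. *)
exists (maxn 1 (maxn n1 n2)) => m; rewrite !geq_max => /and3P[m0 /H1 h1 /H2 h2].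
have s0 : 0 < (B * t `^ b / x `^ a) `^ (1 / (a + b + 1)) *
    m%:R `^ (a / (a + b + 1)).
  by rewrite mulr_gt0 ?powR_gt0 ?divr_gt0 ?mulr_gt0 ?powR_gt0 ?ltr0n.
by split; [rewrite ler_pdivlMr // mulrC mulrA mulr1|rewrite ler_pdivrMr].
Qed.
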